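(* Let $V$ be a finite set with $\#V=n$, $f,g:\mathcal P(V)^k\to\mathbb R$, and let $F=f^M_\triangle$, $G=g^M_\triangle$ be such that $F$ and $G$ are even and $G(x)\ne0$ for $x\ne0$. Let $\lambda_i$ be the $i$-th min-max eigenvalue of the function pair $(F,G)$, $i=1,\dots,n$. Then for every $\lambda\in\mathbb R$ $$\alpha_\lambda\le\min\{\#\{i:\lambda_i\le\lambda\},\ \#\{i:\lambda_i\ge\lambda\}\}.$$ Moreover, for any eigenvector $x$ corresponding to the eigenvalue $\lambda_j$ whose multiplicity is $r$, $$N(x)\le\min\{j+r-1,\ n-j+r\}.$$
   Context: Piecewise multilinear extension: for $h:\mathcal P(V)^k\to\mathbb R$ define $$h^M(x^1,\dots,x^k)=\sum_{i_1,\dots,i_k=0}^{n-1}\prod_{s=1}^k\big(x^s_{(i_s+1)}-x^s_{(i_s)}\big)h\big(V^{(i_1)}(x^1),\dots,V^{(i_k)}(x^k)\big),$$ where $x^s_{(1)}\le\dots\le x^s_{(n)}$ is the non-decreasing rearrangement of $x^s\in\mathbb R^n$, $x^s_{(0)}:=0$, $V^{(0)}(x^s):=V$, $V^{(i)}(x^s):=\{j\in V:x^s_j>x^s_{(i)}\}$ for $i\ge1$ (and $h:=0$ if an argument is empty); $h^M_\triangle(x):=h^M(x,\dots,x)$ for $x\in\mathbb R^n$. Eigenpair of $(F,G)$: $(\lambda,x)$ with $x\neq0$ and $\nabla F(x)\cap\lambda\nabla G(x)\ne\varnothing$, where $\nabla$ is the Clarke subdifferential. The genus of a nonempty symmetric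 set $A=-A\subset\mathbb R^n\setminus\{0\}$ is the least $s\ge1$ such that there is an odd continuous map $A\to\mathbb S^{s-1}$. Min-max eigenvalues: $\lambda_i=\inf_{A}\sup_{x\in A}F(x)/G(x)$, the infimum over compact symmetric $A\subset\mathbb R^n\setminus\{0\}$ with genus $\ge i$. The multiplicity of an eigenvalue $\lambda$ is the genus of the set of all eigenvectors with eigenvalue $\lambda$. Independence number: $\alpha_\lambda=\max\{\#A:\ A\subset V,\ F(x)/G(x)=\lambda\ \text{for all } x\ne0 \text{ with } \mathrm{supp}(x)\subset A\}$. $N(x)$ is the largest $s$ for which there are pairwise disjoint nonempty sets $U_1,\dots,U_s\subset\mathrm{supp}(x)$ with $$\frac{F(\sum_{i=1}^st_i\,x|_{U_i})}{G(\sum_{i=1}^st_i\,x|_{U_i})}=\frac{F(x)}{G(x)}\quad\text{for all }(t_1,\dots,t_s)\in\mathbb R^s\setminus\{0\},$$ where $x|_U$ equals $x$ on $U$ and $0$ elsewhere. *)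

(* Defs.v *)
From HB Require Import structures.
From mathcomp Require Import all_boot all_order all_algebra.
From mathcomp Require Import all_classical all_reals all_analysis.

Set Implicit Arguments.
Unset Strict Implicit.
Unset Printing Implicit Defensive.

Import Order.TTheory GRing.Theory Num.Theory.
Import numFieldNormedType.Exports.

Local Open Scope classical_set_scope.
Local Open Scope ring_scope.

(* The ground set V with #V = n is 'I_n, so that R^V is 'rV[R]_n; a set
   function P(V)^k -> R has type {ffun 'I_k -> {set 'I_n}} -> R. *)

Section MultilinearExtension.
Context {R : realType} {n k : nat}.

(* order_stat x 0 = 0, and order_stat x i is the i-th smallest coordinate of x
   for 1 <= i <= n. *)
Definition order_stat (x : 'rV[R]_n) (i : nat) : R :=
  nth 0 (0 :: sort <=%R [seq x ord0 j | j <- enum 'I_n]) i.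

Definition upper_set (x : 'rV[R]_n) (i : nat) : {set 'I_n} :=
  if i == 0%N then [set: 'I_n]%SET
  else [set j | order_stat x i < x ord0 j]%SET.

(* h, with value 0 as soon as one argument is empty *)
Definition zero_on_empty (h : {ffun 'I_k -> {set 'I_n}} -> R)
    (A : {ffun 'I_k -> {set 'I_n}}) : R :=
  if [exists s, A s == finset.set0] then 0 else h A.

Definition mlext (h : {ffun 'I_k -> {set 'I_n}} -> R)
    (x : 'I_k -> 'rV[R]_n) : R :=
  \sum_(i : {ffun 'I_k -> 'I_n})
    (\prod_(s < k) (order_stat (x s) (i s).+1 - order_stat (x s) (i s))) *
    zero_on_empty h [ffun s => upper_set (x s) (i s)].

Definition mlext_diag (h : {ffun 'I_k -> {set 'I_n}} -> R)
    (x : 'rV[R]_n) : R := mlext h (fun=> x).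

End MultilinearExtension.

Section Clarke.
Context {R : realType} {n : nat}.
Implicit Types (F G : 'rV[R]_n -> R) (x v : 'rV[R]_n).

(* limsup of (F (y + t v) - F y) / t as y --> x, t --> 0+ *)
Definition clarke_dd F x v : \bar R :=
  limf_esup (fun p : 'rV[R]_n * R => ((F (p.1 + p.2 *: v) - F p.1) / p.2)%:E)
    (filter_prod (nbhs x) 0^'+).

Definition clarke F x : set 'rV[R]_n :=
  [set xi | forall v,
    ((\sum_(j < n) xi ord0 j * v ord0 j)%:E <= clarke_dd F x v)%E].

Definition eigenpair F G (lam : R) x : Prop :=
  x != 0 /\ clarke F x `&` [set lam *: xi | xi in clarke G x] !=set0.

End Clarke.

Section MinMax.
Context {R : realType} {n : nat}.
Implicit Types (A : set 'rV[R]_n) (F G : 'rV[R]_n -> R).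

Definition symmetric_off0 A : Prop :=
  (forall x, A x -> A (- x)) /\ ~ A 0.

(* the Euclidean unit sphere of R^s, of dimension s - 1 *)
Definition sphere (s : nat) : set 'rV[R]_s :=
  [set y | \sum_(i < s) y ord0 i ^+ 2 = 1].

Definition odd_map_to_sphere A (s : nat) : Prop :=
  exists phi : 'rV[R]_n -> 'rV[R]_s,
    [/\ {within A, continuous phi},
        forall x, A x -> sphere (phi x)
      & forall x, A x -> phi (- x) = - phi x].

Definition is_genus A (s : nat) : Prop :=
  [/\ A !=set0, symmetric_off0 A, (1 <= s)%N, odd_map_to_sphere A s
    & forall t, (1 <= t)%N -> odd_map_to_sphere A t -> (s <= t)%N].

Definition minmax_family (i : nat) : set (set 'rV[R]_n) :=
  [set A | [/\ compact A, symmetric_off0 A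
             & exists s, is_genus A s /\ (i <= s)%N]].

Definition minmax_eigenvalue F G (i : nat) : \bar R :=
  ereal_inf [set ereal_sup [set (F x / G x)%:E | x in A]
            | A in minmax_family i].

Definition multiplicity_is F G (lam : R) (r : nat) : Prop :=
  is_genus [set x | eigenpair F G lam x] r.

End MinMax.

Section Independence.
Context {R : realType} {n : nat}.
Implicit Types (F G : 'rV[R]_n -> R) (x : 'rV[R]_n).

Definition supp x : {set 'I_n} := [set j | x ord0 j != 0]%SET.

(* the empty set always qualifies, so this is a maximum over a nonempty family *)
Definition independence_number F G (lam : R) : nat :=
  \max_(A : {set 'I_n} | `[< forall x, x != 0 -> supp x \subset A ->
                                F x / G x = lam >]) #|A|.

Definition restr x (U : {set 'I_n}) : 'rV[R]_n :=
  \row_j (if j \in U then x ord0 j else 0).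

Definition constant_ratio_split F G x (s : nat) : Prop :=
  exists U : 'I_s -> {set 'I_n},
    [/\ forall i, U i != finset.set0 /\ U i \subset supp x,
        forall i j, i != j -> (U i :&: U j)%SET = finset.set0
      & forall t : 'rV[R]_s, t != 0 ->
          F (\sum_(i < s) t ord0 i *: restr x (U i)) /
          G (\sum_(i < s) t ord0 i *: restr x (U i)) = F x / G x].

(* disjoint nonempty subsets of 'I_n number at most n, hence the bound *)
Definition split_number F G x : nat :=
  \max_(s < n.+1 | `[< constant_ratio_split F G x s >]) s.

End Independence.

(* Main.v *)
Require Import Defs.
From mathcomp Require Import all_boot all_order all_algebra finmap.
From mathcomp Require Import all_classical all_reals all_analysis.
From mathcomp Require Import zify ring lra.

Set Implicit Arguments.
Unset Strict Implicit.
Unset Printing Implicit Defensive.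

Import Order.TTheory GRing.Theory Num.Theory.
Import numFieldNormedType.Exports.

Local Open Scope classical_set_scope.
Local Open Scope ring_scope.

(** Write J = F / G. Both functions are homogeneous of degree k and even, so J
    is constant on rays and even, and they are locally Lipschitz, because the
    multilinear extension is a polynomial in the Lipschitz functions [weight].

    Suppose that J is equal to lam on the nonzero vectors of an s-dimensional
    subspace. A thick sphere of the subspace is a compact symmetric set, of
    genus at least s by the Borsuk-Ulam theorem, so the first s min-max values
    are at most lam ([subspace_minmax_le]). Every symmetric set of genus more
    than n - s meets the subspace, since otherwise a projection would map it
    oddly to a sphere of dimension n - s - 1; so the last s values are at least
    lam ([subspace_minmax_ge]). For the coordinate subspace of an independent
    set this is the first claim.

    For the second claim the vectors x restricted to the sets U_i span such a
    subspace, of dimension s = N(x); its constant ratio is lam by Euler's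
    identity for Clarke subgradients ([clarke_euler]), or because J is constant
    on all nonzero vectors when k = 0. If s exceeded j + r - 1,
    the values of index j and j + r would both be lam, and if it exceeded
    n - j + r, so would those of index j - r and j. Both are excluded by the
    multiplicity theorem [minmax_multiplicity]: when r + 1 consecutive min-max
    values coincide, the set of eigenvectors has genus more than r.

    The multiplicity theorem rests on a deformation. A nonzero x with J x = lam
    which is not an eigenvector has, by Hahn-Banach separation of the two Clarke
    subdifferentials, a direction in which J decreases near x
    ([not_noncritical_eigenpair], [ratio_descent]); finitely many small pushes in
    such directions compose to an odd map that lowers J on a given compact set
    of such points ([compact_descent_map]).

    The Borsuk-Ulam theorem is derived from Tucker's lemma for a cubical grid
    ([tucker]), proved by counting modulo 2 the flags of faces whose labels
    form a given set. *)

(** * Tucker's lemma on a cubical grid *)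

Lemma addrr_F2 (x : 'F_2) : x + x = 0.
Proof. by apply: val_inj; case: x => [[|[|]]]. Qed.

Lemma eq_of_addr_F2 (x y : 'F_2) : x + y = 0 -> x = y.
Proof. by move=> h; rewrite -[x]addr0 -(addrr_F2 y) addrA h add0r. Qed.

(** The terms at [x] and [i x] cancel in pairs. *)
Lemma sum_invol_F2 (T : finType) (i : T -> T) (f : T -> 'F_2) :
  involutive i -> (forall x, f (i x) = f x) -> (forall x, i x = x -> f x = 0) ->
  \sum_x f x = 0.
Proof.
move=> iK fi f0.
rewrite (bigID (fun x => enum_rank x < enum_rank (i x))%N) /=.
rewrite [X in _ + X](bigID (fun x => enum_rank (i x) < enum_rank x)%N) /=.
rewrite [X in _ + (_ + X)]big1 ?addr0; last first.
  move=> x /andP[]; rewrite -!leqNgt => h1 h2.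
  apply: f0; apply: enum_rank_inj; apply/val_inj/eqP.
  by rewrite eqn_leq h1 h2.
rewrite [X in _ + X](reindex_inj (inv_inj iK)) /=.
rewrite [X in _ + X](eq_big (fun x => enum_rank x < enum_rank (i x))%N f) ?addrr_F2 //.
by move=> x; rewrite !iK -leqNgt andbC; case: ltnP => //= /ltnW ->.
Qed.

Section Tucker.
Variables (m N : nat).
Hypothesis N0 : (0 < N)%N.

Notation M := (N * 4)%N.
Notation z := (N * 2)%N.
(** A cell of the cube [-1, 1]^m cut into (2N)^m small cubes. On each axis the
    position [p] stands for the point (p - 2N) / 2N: even positions are the
    vertices of the cut interval and odd positions are its open edges, so that
    the dimension of a cell is its number of odd coordinates. *)
Notation cell := {ffun 'I_m -> 'I_M.+1}.
Notation L := ('I_m * bool)%type.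

Implicit Types (c u w : cell) (S : {set L}) (e l : L) (f : cell -> 'F_2) (i j : 'I_m) (b : bool).

(** For an odd coordinate [c j], the facets of [c] orthogonal to the axis [j]
    are [shift true c j] and [shift false c j]. *)
Definition shift (b : bool) (c : cell) (j : 'I_m) : cell :=
  [ffun i => if i == j then inord (if b then (c i).+1 else (c i).-1) else c i].

Lemma shift_ne b c j i : i != j -> shift b c j i = c i.
Proof. by rewrite ffunE => /negPf ->. Qed.

Lemma shift_eq b c j : odd (c j) ->
  shift b c j j = (if b then (c j).+1 else (c j).-1) :> nat.
Proof.
move=> oc; rewrite ffunE eqxx inordK //.
have := ltn_ord (c j); case: b; move: oc; lia.
Qed.

Lemma shiftC b b' c i j : i != j ->
  shift b (shift b' c j) i = shift b' (shift b c i) j.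
Proof.
move=> ij; apply/ffunP => l; rewrite !ffunE.
by case: (eqVneq l i) => [->|//]; rewrite (negPf ij).
Qed.

(** Functions from cells to F_2 are cochains; [cobdry] is the coboundary operator,
    and [cobdry_dir] is its part along one axis. *)
Definition cobdry_dir (f : cell -> 'F_2) (j : 'I_m) (c : cell) : 'F_2 :=
  if odd (c j) then f (shift true c j) + f (shift false c j) else 0.

Definition cobdry (f : cell -> 'F_2) (c : cell) : 'F_2 := \sum_j cobdry_dir f j c.

Lemma eq_cobdry_dir f g j c : (forall b, odd (c j) -> f (shift b c j) = g (shift b c j)) ->
  cobdry_dir f j c = cobdry_dir g j c.
Proof. by rewrite /cobdry_dir; case: ifP => // o H; rewrite !H. Qed.

Lemma cobdry_dirK f j c : cobdry_dir (cobdry_dir f j) j c = 0.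
Proof.
rewrite /cobdry_dir; case: ifP => // o.
have e b : odd (shift b c j j) = false.
  by rewrite shift_eq //; case: b; move: o; lia.
by rewrite !e addr0.
Qed.

Lemma cobdry_dirC f i j c : cobdry_dir (cobdry_dir f i) j c = cobdry_dir (cobdry_dir f j) i c.
Proof.
case: (eqVneq i j) => [->//|ij].
rewrite /cobdry_dir; have ji : j != i by rewrite eq_sym.
rewrite !(shift_ne _ _ ij) !(shift_ne _ _ ji).
case: ifP => oj; case: ifP => oi; rewrite ?addr0 //.
by rewrite !(shiftC _ _ _ ij) addrACA.
Qed.

Lemma cobdry_dir_sum (I : finType) (P : pred I) (f : I -> cell -> 'F_2) j c :
  cobdry_dir (fun u => \sum_(i | P i) f i u) j c = \sum_(i | P i) cobdry_dir (f i) j c.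
Proof. by rewrite /cobdry_dir; case: ifP => _; [rewrite big_split|rewrite big1]. Qed.

Lemma cobdry_sum (I : finType) (P : pred I) (f : I -> cell -> 'F_2) c :
  cobdry (fun u => \sum_(i | P i) f i u) c = \sum_(i | P i) cobdry (f i) c.
Proof. by rewrite /cobdry exchange_big; apply: eq_bigr => j _; rewrite cobdry_dir_sum. Qed.

(** A face of codimension two arises by collapsing two distinct axes, in either
    order, so that it is counted twice. *)
Lemma cobdryK f c : cobdry (cobdry f) c = 0.
Proof.
rewrite /cobdry; under eq_bigr do rewrite cobdry_dir_sum.
rewrite pair_big /= (@sum_invol_F2 _ (fun p => (p.2, p.1)) (fun p => cobdry_dir (cobdry_dir f p.2) p.1 c)) //.
- by case.
- by case=> i j /=; rewrite cobdry_dirC.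
- by case=> i j /= [->]; rewrite cobdry_dirK.
Qed.

Variable lab : cell -> L.

Definition even_cell (c : cell) : bool := [forall j, ~~ odd (c j)].

(** Parities of complete flags of faces (one face in each dimension) on which the
    label takes each value of [S] exactly once: [flags S u] counts those whose
    largest face is [u], and [flags_below S c] those whose largest face is a
    facet of [c]. For empty [S] the recursion starts at the empty flag, which lies
    below the vertices. *)
Fixpoint flags_below_rec (n : nat) (S : {set L}) (c : cell) : 'F_2 :=
  if n is n'.+1 then
    cobdry (fun u => if lab u \in S then flags_below_rec n' (S :\ lab u) u else 0) c
  else (even_cell c)%:R.

Definition flags_below S := flags_below_rec #|S| S.
Definition flags S (u : cell) : 'F_2 :=
  if lab u \in S then flags_below (S :\ lab u) u else 0.

Lemma flags_belowE S c : S != finset.set0 -> flags_below S c = cobdry (flags S) c.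
Proof.
rewrite -card_gt0 /flags_below; case E : #|S| => [//|k] _ /=.
apply: eq_bigr => j _; apply: eq_cobdry_dir => b _; rewrite /flags; case: ifP => // h.
by rewrite /flags_below; have := cardsD1 (lab (shift b c j)) S; rewrite h E add1n => -[<-].
Qed.

Lemma flags_below0 c : flags_below finset.set0 c = (even_cell c)%:R.
Proof. by rewrite /flags_below cards0. Qed.

Lemma cobdry_flags_below S c : cobdry (flags_below S) c = 0.
Proof.
have [->|S0] := eqVneq S finset.set0; last first.
  rewrite -[RHS](cobdryK (flags S) c); apply: eq_bigr => j _.
  by apply: eq_cobdry_dir => b _; rewrite flags_belowE.
rewrite /cobdry big1 // => j _; rewrite /cobdry_dir; case: ifP => // o.
rewrite !flags_below0.
suff -> : even_cell (shift true c j) = even_cell (shift false c j) by rewrite addrr_F2.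
apply: eq_forallb => i; case: (eqVneq i j) => [->|ij]; last by rewrite !shift_ne.
rewrite !shift_eq //=; move: o; lia.
Qed.

(** The Sperner-type identity behind Tucker's lemma. When [lab c] is not in [S],
    the only way to complete a flag labelled by [S] is by [c] itself. When it is,
    the induction hypothesis for [S :\ lab c] rewrites the right-hand side as the
    coboundary of a coboundary plus the left-hand side. *)
Lemma flags_below_sum S c : flags_below S c = \sum_(e | e \notin S) flags (e |: S) c.
Proof.
have [n le] := ubnP #|S|; elim: n => // n IH in S c le *.
case: (boolP (lab c \in S)) => lS; last first.
  rewrite (bigD1 (lab c)) //= big1 ?addr0.
    by rewrite /flags setU11 finset.setU1K.
  move=> e /andP[eS el]; rewrite /flags in_setU1 (negPf lS) orbF.
  by rewrite eq_sym (negPf el).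
have S0 : S != finset.set0 by apply/set0Pn; exists (lab c).
set S' := S :\ lab c.
have cS' : (#|S'| < n)%N.
  by move: le; rewrite (cardsD1 (lab c)) lS /= ltnS add1n.
have step e : e \notin S -> flags (e |: S) c = flags_below (e |: S') c.
  move=> eS; rewrite /flags in_setU1 lS orbT; congr (flags_below _ c).
  apply/setP => x; rewrite !inE.
  by case: (eqVneq x e) => // ->; case: eqVneq => // E; rewrite E lS in eS.
rewrite (eq_bigr _ step).
have E1 : cobdry (flags_below S') c = cobdry (fun u => \sum_(e | e \notin S') flags (e |: S') u) c.
  by apply: eq_bigr => j _; apply: eq_cobdry_dir => b _; apply: IH.
rewrite cobdry_flags_below cobdry_sum (bigD1 (lab c)) /= in E1; last by rewrite !inE eqxx.
rewrite finset.setD1K // -flags_belowE // in E1.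
have E2 : \sum_(i | (i \notin S') && (i != lab c)) cobdry (flags (i |: S')) c
   = \sum_(e | e \notin S) flags_below (e |: S') c.
  apply: eq_big => [i|i _].
    by rewrite !inE; case: (eqVneq i (lab c)) => [->|_] /=; rewrite ?lS ?andbT.
  by rewrite flags_belowE //; apply/set0Pn; exists i; rewrite setU11.
rewrite E2 in E1.
move: E1; rewrite -/S'; set x := flags_below S c; set y := \sum_(e | _) _ => E1.
by rewrite -[y]add0r -(addrr_F2 x) -addrA -E1 addr0.
Qed.

Definition face (w c : cell) : Prop :=
  forall j, w j = c j \/ (odd (c j) /\ ~~ odd (w j) /\
     ((w j = (c j).+1 :> nat) \/ (c j = (w j).+1 :> nat))).

Lemma face_refl c : face c c. Proof. by left. Qed.

Lemma face_shift b c j w : odd (c j) -> face w (shift b c j) -> face w c.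
Proof.
move=> o H i; case: (eqVneq i j) => [->|ij].
  have := H j; have := shift_eq b o => E.
  have ne : odd (shift b c j j) = false by rewrite E; case: (b); move: o; lia.
  rewrite ne => -[wE|[]//]; right; rewrite wE o ne E; split=> //; split=> //.
  by case: (b); [left|right]; move: o; lia.
by have := H i; rewrite shift_ne.
Qed.

Lemma cobdry_dir_neq0 f j c : cobdry_dir f j c != 0 -> odd (c j) /\ exists b, f (shift b c j) != 0.
Proof.
rewrite /cobdry_dir; case: ifP => o; rewrite ?eqxx // => h; split=> //.
have [e|] := eqVneq (f (shift true c j)) 0; last by exists true.
by exists false; rewrite e add0r in h.
Qed.

Lemma cobdry_neq0 f c : cobdry f c != 0 -> exists j b, odd (c j) /\ f (shift b c j) != 0.
Proof.
move=> h; have [/existsP[j hj]|/existsPn H] := boolP [exists j, cobdry_dir f j c != 0].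
  by have [od [b fb]] := cobdry_dir_neq0 hj; exists j, b.
by move: h; rewrite /cobdry big1 ?eqxx // => j _; apply/eqP; rewrite -[_ == _]negbK H.
Qed.

(** The labels of a flag are carried by its members, which are faces of the
    largest one. *)
Lemma flags_face S c : flags S c != 0 ->
  forall l, l \in S -> exists w, face w c /\ lab w = l.
Proof.
have [n le] := ubnP #|S|; elim: n => // n IH in S c le *.
rewrite /flags; case: ifP => lS; rewrite ?eqxx // => h l l_S.
have [<-|nl] := eqVneq (lab c) l; first by exists c; split => //; apply: face_refl.
have lS' : l \in S :\ lab c by rewrite !inE eq_sym nl.
rewrite flags_belowE in h; last by apply/set0Pn; exists l.
have [j [b [od au]]] := cobdry_neq0 h.
have [] := IH _ _ _ au l lS'.
  by move: le; rewrite (cardsD1 (lab c)) lS add1n ltnS.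
by move=> w [fw lw]; exists w; split => //; apply: face_shift fw.
Qed.

Definition opp_label (l : L) : L := (l.1, ~~ l.2).
Lemma opp_labelK : involutive opp_label. Proof. by case=> i b; rewrite /opp_label negbK. Qed.

(** From here on the label is a counterexample to Tucker's lemma. *)
Hypothesis no_opposite : forall w c, face w c -> lab w <> opp_label (lab c).

(** Two members of a flag are comparable, hence cannot carry opposite labels. *)
Lemma flags_inconsistent S c l : l \in S -> opp_label l \in S -> flags S c = 0.
Proof.
have [n le] := ubnP #|S|; elim: n => // n IH in S c le * => lS olS.
apply/eqP/negPn/negP => h.
have h' := h; move: h; rewrite /flags; case: ifP => cS; rewrite ?eqxx // => h.
have [w [fw lw]] := flags_face h' lS; have [w' [fw' lw']] := flags_face h' olS.
have [E|n1] := eqVneq (lab c) l; first by case: (no_opposite fw'); rewrite E.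
have [E|n2] := eqVneq (lab c) (opp_label l); first by case: (no_opposite fw); rewrite E opp_labelK.
rewrite flags_belowE in h; last by apply/set0Pn; exists l; rewrite !inE eq_sym n1.
have [j [b [od au]]] := cobdry_neq0 h.
move: au; rewrite (IH _ _ _ _ _) ?eqxx //.
- by move: le; rewrite (cardsD1 (lab c)) cS add1n ltnS.
- by rewrite !inE eq_sym n1.
- by rewrite !inE eq_sym n2.
Qed.

(** Along the axis [j], each vertex strictly between [lo] and [hi] bounds two of
    the edges in the sum, whence only both ends survive modulo 2. *)
Lemma telescope (P : pred cell) (f : cell -> 'F_2) j lo hi :
  (forall c c' : cell, (forall i, i != j -> c i = c' i) -> P c = P c') ->
  ~~ odd lo -> ~~ odd hi -> (lo <= hi)%N -> (hi <= M)%N ->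
  \sum_(c | [&& P c, odd (c j) & lo < c j < hi]%N) cobdry_dir f j c =
  \sum_(u | P u && (u j == lo :> nat)) f u + \sum_(u | P u && (u j == hi :> nat)) f u.
Proof.
move=> HP elo ehi lh hM.
have -> : \sum_(c | [&& P c, odd (c j) & lo < c j < hi]%N) cobdry_dir f j c =
  \sum_(c | [&& P c, odd (c j) & lo < c j < hi]%N) f (shift true c j) +
  \sum_(c | [&& P c, odd (c j) & lo < c j < hi]%N) f (shift false c j).
  by rewrite -big_split; apply: eq_bigr => c /and3P[_ o _]; rewrite /cobdry_dir o.
pose Q (u : cell) := [&& P u, ~~ odd (u j) & (lo <= u j <= hi)%N].
have one b : \sum_(c | [&& P c, odd (c j) & lo < c j < hi]%N) f (shift b c j) =
   \sum_(u | Q u && (u j != (if b then lo else hi) :> nat)) f u.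
  rewrite [RHS](reindex_onto (fun c => shift b c j)
     (fun u : cell => [ffun i => if i == j then inord (if b then (u i).-1 else (u i).+1) else u i])) /=; last first.
    move=> u /andP[/and3P[_ eu le] ne]; apply/ffunP => i; rewrite !ffunE.
    case: eqP => // ->; apply: ord_inj; have := ltn_ord (u j) => lu.
    move: eu le ne lu; set v := nat_of_ord (u j) => eu le ne lu.
    case: b ne => ne; rewrite !inordK; move: eu le elo ehi lu hM ne; lia.
  apply: eq_bigl => c.
  have PE : P (shift b c j) = P c by apply: HP => i ij; rewrite shift_ne.
  rewrite /Q PE; case: (P c) => //=.
  have lc := ltn_ord (c j).
  case o : (odd (c j)) => /=.
    have -> : [ffun i => if i == j then inord (if b then (shift b c j i).-1 else (shift b c j i).+1)
          else shift b c j i] == c.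
      apply/eqP/ffunP => i; rewrite ffunE; case: eqVneq => [->|ij].
        apply: ord_inj; rewrite shift_eq //; move: o lc; set v := nat_of_ord (c j) => o lc.
        rewrite inordK; case: (b); move: o lc; lia.
      by rewrite shift_ne.
    rewrite andbT shift_eq //; case: (b); apply/idP/idP; move: o lc elo ehi; lia.
  apply/esym/negP => /andP[/andP[/andP[h1 h2] h3] /eqP/ffunP/(_ j)].
  rewrite ffunE eqxx => /(congr1 (@nat_of_ord _)).
  have lsj := ltn_ord (shift b c j j).
  move: h1 h2 h3 lsj o lc; set v := nat_of_ord (shift b c j j); set w := nat_of_ord (c j).
  by case: (b) => h1 h2 h3 lsj o lc; rewrite inordK; move: h1 h2 h3 lsj o lc elo ehi hM; lia.
rewrite !one.
have split1 x : ~~ odd x -> (lo <= x <= hi)%N -> \sum_(u | Q u) f u =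
   \sum_(u | P u && (u j == x :> nat)) f u + \sum_(u | Q u && (u j != x :> nat)) f u.
  move=> ex lx; rewrite (bigID (fun u : cell => u j == x :> nat)) /=; congr (_ + _).
  apply: eq_bigl => u; rewrite /Q; case: (P u) => //=.
  by case: eqP => [->|]; rewrite ?andbF // ex lx.
have E := split1 lo elo; rewrite leqnn lh in E; have {}E := E isT.
have E' := split1 hi ehi; rewrite leqnn lh in E'; have {}E' := E' isT.
have := addrr_F2 (\sum_(u | Q u) f u); rewrite {1}E E' => E0.
set a := \sum_(u | P u && (u j == lo :> nat)) f u in E0 *.
set b := \sum_(u | P u && (u j == hi :> nat)) f u in E0 *.
set c := \sum_(u | Q u && (u j != lo :> nat)) f u in E0 *.
set d := \sum_(u | Q u && (u j != hi :> nat)) f u in E0 *.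
rewrite addrACA in E0.
exact/esym/eq_of_addr_F2.
Qed.

(** A set of labels prescribes signs of coordinates, and [in_orthant S] singles
    out the cells of dimension [#|S|] in the orthant of the prescribed signs, all
    other coordinates being at the centre. A set with two opposite labels gives no
    cell at all. *)
Definition orthant_coord (S : {set L}) (j : 'I_m) (a : nat) : bool :=
  [&& ((j, true) \in S) ==> odd a && (z < a)%N,
      ((j, false) \in S) ==> odd a && (a < z)%N &
      ((j, true) \notin S) && ((j, false) \notin S) ==> (a == z)].

Definition in_orthant S (c : cell) := [forall j, orthant_coord S j (c j)].
Definition outer_coord (b : bool) : nat := if b then M else 0.
(** The facets of the cells of [in_orthant S] which lie on the side of the cube
    named by the label [e]. *)
Definition on_outer_face S (e : L) (c : cell) :=
  [forall j, (j != e.1) ==> orthant_coord S j (c j)] && (c e.1 == outer_coord e.2 :> nat).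

(** Of the two walls of an orthant across one axis, the inner one is the smaller
    orthant without that sign and the outer one lies on the side of the cube. *)
Lemma orthant_boundary_dir S e (f : cell -> 'F_2) : e \in S -> opp_label e \notin S ->
  \sum_(c | in_orthant S c) cobdry_dir f e.1 c =
  \sum_(u | in_orthant (S :\ e) u) f u + \sum_(u | on_outer_face S e u) f u.
Proof.
case: e => j b /= eS oeS.
pose P (c : cell) := [forall i, (i != j) ==> orthant_coord S i (c i)].
have HP (c c' : cell) : (forall i, i != j -> c i = c' i) -> P c = P c'.
  move=> h; apply: eq_forallb => i; case: eqVneq => //= ij; by rewrite h.
have splitP (Q : 'I_m -> pred nat) (c : cell) : (forall i, i != j -> Q i =1 orthant_coord S i) ->
   [forall i, Q i (c i)] = P c && Q j (c j).
  move=> h; apply/forallP/andP => [H|[/forallP H1 H2] i].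
    split; last exact: H; apply/forallP => i; apply/implyP => ij.
    by rewrite -h.
  by case: (eqVneq i j) => [->//|ij]; rewrite h //; move: (H1 i); rewrite ij.
pose lo := if b then z else 0%N; pose hi := if b then M else z.
have CE c : in_orthant S c = [&& P c, odd (c j) & lo < c j < hi]%N.
  rewrite /in_orthant splitP //; congr andb; rewrite /orthant_coord /lo /hi.
  have := ltn_ord (c j).
  by case: (b) eS oeS => -> /negPf -> /= H; case o: (odd (c j)) => //=; move: o H; lia.
have C'E (u : cell) : in_orthant (S :\ (j, b)) u = P u && (u j == z :> nat).
  rewrite /in_orthant splitP /orthant_coord => [|i ij a]; last by rewrite !inE !xpair_eqE (negPf ij).
  congr andb; rewrite !inE !xpair_eqE eqxx /=.
  by case: (b) eS oeS => -> /negPf -> /=.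
rewrite (eq_bigl _ _ CE) (telescope _ HP); rewrite /lo /hi; last 4 first.
- by case: (b); lia.
- by case: (b); lia.
- by case: (b); lia.
- by case: (b); lia.
rewrite (eq_bigl _ _ C'E) /on_outer_face /outer_coord /=.
by case: (b) => //; rewrite addrC.
Qed.

Definition antipode (c : cell) : cell := [ffun i => rev_ord (c i)].
Lemma antipodeK : involutive antipode.
Proof. by move=> c; apply/ffunP => i; rewrite !ffunE rev_ordK. Qed.

Lemma odd_antipode c i : odd (antipode c i) = odd (c i).
Proof. by rewrite ffunE /=; have := ltn_ord (c i); lia. Qed.

Lemma antipode_shift b c j : odd (c j) -> antipode (shift b c j) = shift (~~ b) (antipode c) j.
Proof.
move=> o; apply/ffunP => i; case: (eqVneq i j) => [->|ij]; last first.
  by rewrite shift_ne // !ffunE (negPf ij).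
apply: ord_inj; rewrite shift_eq ?odd_antipode // !ffunE eqxx /=.
move: (ltn_ord (c j)) o; set v := nat_of_ord (c j) => lc o.
case: b; rewrite /= inordK; move: o lc; lia.
Qed.

Definition on_boundary (c : cell) := [exists j, (c j == 0%N :> nat) || (c j == M :> nat)].

Hypothesis lab_antipode : forall c, on_boundary c -> lab (antipode c) = opp_label (lab c).

Definition opp_labels (S : {set L}) : {set L} := [set l | opp_label l \in S].
Lemma opp_labelsK : involutive opp_labels.
Proof. by move=> S; apply/setP => l; rewrite !inE opp_labelK. Qed.

Lemma on_boundary_shift b c j : odd (c j) -> on_boundary c -> on_boundary (shift b c j).
Proof.
move=> o /existsP[i hi]; apply/existsP; exists i; rewrite shift_ne //.
by apply/eqP => E; move: hi o; rewrite E; lia.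
Qed.

Lemma flags_below_antipodal S c : on_boundary c -> flags_below (opp_labels S) (antipode c) = flags_below S c.
Proof.
have [n le] := ubnP #|S|; elim: n => // n IH in S c le * => bc.
have [->|S0] := eqVneq S finset.set0.
  have -> : opp_labels finset.set0 = finset.set0 by apply/setP => l; rewrite !inE.
  rewrite !flags_below0; congr (_%:R); congr nat_of_bool.
  by apply: eq_forallb => i; rewrite odd_antipode.
have S0' : opp_labels S != finset.set0.
  by case/set0Pn: S0 => l lS; apply/set0Pn; exists (opp_label l); rewrite inE opp_labelK.
rewrite !flags_belowE //; apply: eq_bigr => j _; rewrite /cobdry_dir odd_antipode; case: ifP => // o.
have E b : flags (opp_labels S) (shift (~~ b) (antipode c) j) = flags S (shift b c j).
  rewrite -antipode_shift // /flags lab_antipode ?on_boundary_shift // inE opp_labelK; case: ifP => // lS.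
  have -> : opp_labels S :\ opp_label (lab (shift b c j)) = opp_labels (S :\ lab (shift b c j)).
    by apply/setP => l; rewrite !inE (can2_eq opp_labelK opp_labelK).
  apply: IH; last exact: on_boundary_shift.
  by move: le; rewrite (cardsD1 (lab (shift b c j))) lS add1n ltnS.
by rewrite -(E true) -(E false) addrC.
Qed.

Lemma flags_antipodal S c : on_boundary c -> flags (opp_labels S) (antipode c) = flags S c.
Proof.
move=> bc; rewrite /flags lab_antipode // inE opp_labelK; case: ifP => // lS.
have -> : opp_labels S :\ opp_label (lab c) = opp_labels (S :\ lab c).
  by apply/setP => l; rewrite !inE (can2_eq opp_labelK opp_labelK).
exact: flags_below_antipodal.
Qed.

Definition outer_flags S : 'F_2 := \sum_(e | e \in S) \sum_(u | on_outer_face S e u) flags S u.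

Lemma on_outer_face_opp S e u : on_outer_face (opp_labels S) (opp_label e) (antipode u) = on_outer_face S e u.
Proof.
rewrite /on_outer_face /=; congr andb.
  apply: eq_forallb => i; congr implb; rewrite /orthant_coord !inE /opp_label /= !odd_antipode ffunE /=.
  have lu := ltn_ord (u i).
  case: ((i, true) \in S); case: ((i, false) \in S) => //=; move: lu; lia.
rewrite ffunE /=; case: e => j b /=; have lu := ltn_ord (u j).
by case: b => /=; move: lu; lia.
Qed.

Lemma outer_flags_opp S : outer_flags (opp_labels S) = outer_flags S.
Proof.
rewrite /outer_flags (reindex_inj (inv_inj opp_labelK)) /=.
rewrite (eq_bigl (mem S)) => [|e]; last by rewrite inE opp_labelK.
apply: eq_bigr => e eS; rewrite (reindex_inj (inv_inj antipodeK)) /=.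
rewrite (eq_bigl _ _ (on_outer_face_opp S e)); apply: eq_bigr => u /andP[_ hu].
apply: flags_antipodal; apply/existsP; exists e.1.
by move: hu; rewrite /outer_coord; case: (e.2) => ->; rewrite ?orbT.
Qed.

(** The antipodal map pairs the contributions of [S] and of the opposite set; a
    set equal to its opposite is empty or contains two opposite labels, and then
    contributes nothing. *)
Lemma sum_outer_flags : \sum_S outer_flags S = 0.
Proof.
apply: (sum_invol_F2 opp_labelsK outer_flags_opp) => S ES.
rewrite /outer_flags big1 // => e eS; rewrite big1 // => u _.
by apply: (flags_inconsistent _ eS); rewrite -ES inE opp_labelK.
Qed.

Lemma orthant_boundary S : S != finset.set0 ->
  \sum_(c | in_orthant S c) flags_below S c =
  \sum_(e | e \in S) \sum_(u | in_orthant (S :\ e) u) flags S u + outer_flags S.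
Proof.
move=> S0; rewrite (eq_bigr (cobdry (flags S))); last by move=> c _; rewrite flags_belowE.
have [/existsP[l /andP[lS olS]]|/existsPn cons] := boolP [exists l in S, opp_label l \in S].
  have a0 c : flags S c = 0 by apply: flags_inconsistent lS olS.
  rewrite big1 => [|c _]; last first.
    by rewrite /cobdry big1 // => j _; rewrite /cobdry_dir !a0 addr0 if_same.
  rewrite big1 => [|e _]; last by rewrite big1.
  by rewrite /outer_flags big1 ?addr0 // => e _; rewrite big1.
have {}cons e : e \in S -> opp_label e \notin S by move=> eS; have := cons e; rewrite eS.
rewrite /cobdry exchange_big /outer_flags -big_split /=.
under [RHS]eq_bigr => e eS do rewrite -(orthant_boundary_dir _ eS (cons e eS)).
rewrite [RHS](partition_big (fun e : L => e.1) xpredT) //=.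
apply: eq_bigr => j _.
have [/existsP[b jb]|/existsPn nj] := boolP [exists b, (j, b) \in S].
  rewrite (big_pred1 (j, b)) //= => -[i b'] /=; rewrite xpair_eqE.
  case: eqVneq => [->|]; rewrite ?andbT ?andbF //=.
  case: (eqVneq b' b) => [->//|bb']; apply/negbTE.
  by have := cons _ jb; rewrite /opp_label /=; case: b b' bb' {jb} => [] [].
rewrite [RHS]big_pred0; last first.
  by move=> [i b] /=; apply/negbTE/negP => /andP[h /eqP E]; have := nj b; rewrite -E h.
apply: big1 => c /forallP/(_ j); rewrite /orthant_coord !(negPf (nj _)) /= => /eqP E.
by rewrite /cobdry_dir E oddM andbF.
Qed.

(** Sum [flags_below S c] over all [S] and all cells [c] of the orthant of [S].
    By [flags_below_sum] this is the sum of [flags T u] over all [T], all [e] in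
    [T] and all [u] in the orthant of [T :\ e]. By [orthant_boundary] it is the
    same sum, plus outer contributions that cancel, plus 1 for the central vertex
    when [S] is empty. *)
Lemma tucker_contradiction : False.
Proof.
have E1 : \sum_(S : {set L}) \sum_(c | in_orthant S c) flags_below S c =
   \sum_(T : {set L}) \sum_(e | e \in T) \sum_(u | in_orthant (T :\ e) u) flags T u.
  under eq_bigr do under eq_bigr do rewrite flags_below_sum.
  under eq_bigr do rewrite exchange_big /=.
  rewrite pair_big_dep [RHS]pair_big_dep /=.
  rewrite (reindex_onto (fun p : {set L} * L => (p.1 :\ p.2, p.2)) (fun p => (p.2 |: p.1, p.2))) /=.
    apply: eq_big => [[T e]|[T e]] /=.
      rewrite !inE eqxx /= xpair_eqE eqxx andbT.
      apply/eqP/idP => [<-|eT]; [exact: setU11 | exact: finset.setD1K].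
    by rewrite !inE eqxx /= xpair_eqE eqxx andbT => /eqP ->.
  by move=> [S e] /= eS; rewrite finset.setU1K.
have E2 : \sum_(S : {set L}) \sum_(c | in_orthant S c) flags_below S c =
   1 + \sum_(T : {set L} ) (\sum_(e | e \in T) \sum_(u | in_orthant (T :\ e) u) flags T u + outer_flags T).
  rewrite (bigD1 finset.set0) //= [X in _ = 1 + X](bigD1 finset.set0) //=.
  rewrite big_set0 /outer_flags big_set0 addr0 add0r; congr (_ + _); last first.
    by apply: eq_bigr => S S0; rewrite orthant_boundary.
  pose c0 : cell := [ffun=> inord z].
  have zM : (z < M.+1)%N by lia.
  rewrite (big_pred1 c0) => [|c].
    rewrite flags_below0; have -> : even_cell c0; last by [].
    by apply/forallP => j; rewrite ffunE inordK // oddM andbF.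
  apply/forallP/eqP => [H|-> j]; last by rewrite /orthant_coord !inE ffunE inordK //=.
  apply/ffunP => j; apply: ord_inj; rewrite ffunE inordK //.
  by have := H j; rewrite /orthant_coord !inE /= => /eqP.
move: E2; rewrite big_split /= sum_outer_flags addr0 E1 => /eqP.
by rewrite -subr_eq subrr eq_sym oner_eq0.
Qed.

End Tucker.

(** Tucker's lemma: a labelling by signed axes that is odd on the boundary of
    the cube takes opposite values on some cell and one of its faces. *)
Lemma tucker m N (lab : {ffun 'I_m -> 'I_(N * 4).+1} -> 'I_m * bool) :
  (0 < N)%N -> (forall c, on_boundary c -> lab (antipode c) = opp_label (lab c)) ->
  exists w c, face w c /\ lab w = opp_label (lab c).
Proof.
move=> N0 lab_antipode; apply: contrapT => none.
by apply: (tucker_contradiction N0 _ lab_antipode) => w c fwc E; apply: none; exists w, c.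
Qed.

(** * Row vectors with the supremum norm *)

Section RowVectors.
Context {R : realType}.

Lemma coord_le_norm n (x : 'rV[R]_n) j : `|x ord0 j| <= `|x|.
Proof.
by rewrite [leRHS]/Num.Def.normr /= mx_normrE; apply/bigmax_geP; right; exists (ord0, j).
Qed.

Lemma norm_leP n (x : 'rV[R]_n) (e : R) : 0 <= e ->
  reflect (forall j, `|x ord0 j| <= e) (`|x| <= e).
Proof.
move=> e0; apply: (iffP idP) => [h j|h]; first exact: le_trans (coord_le_norm _ _) h.
rewrite [leLHS]/Num.Def.normr /= mx_normrE; apply/bigmax_leP; split=> //= -[i j] _ /=.
by rewrite (ord1 i).
Qed.

Lemma norm_attained n (x : 'rV[R]_n) : 0 < `|x| -> exists j, `|x| = `|x ord0 j|.
Proof.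
move=> h; have [|[i j] E] := @mx_norm_neq0 R 1 n x.
  by move: h; rewrite /Num.Def.normr /= => /gt_eqF ->.
by exists j; rewrite [LHS]/Num.Def.normr /= E (ord1 i).
Qed.

Lemma cvg_rowP (T : Type) n (H : set_system T) {FF : Filter H}
    (f : T -> 'rV[R]_n) (a : 'rV[R]_n) :
  (forall j, (fun t => f t ord0 j) @ H --> a ord0 j) -> f @ H --> a.
Proof.
move=> h; apply/cvgrPdist_le => e e0; near=> t.
apply/norm_leP; first exact: ltW.
move=> j; rewrite !mxE; move: j.
near: t; apply: filter_forall => j.
by move/cvgrPdist_le: (h j); apply.
Unshelve. all: by end_near. Qed.

Lemma closed_le_fun (T : topologicalType) (f g : T -> R) :
  continuous f -> continuous g -> closed [set x | f x <= g x].
Proof.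
move=> cf cg.
have -> : [set x | f x <= g x] = (g \- f) @^-1` [set r | 0 <= r].
  by apply/seteqP; split => x /=; rewrite subr_ge0.
apply: preimage_closed; last exact: closed_ge.
by move=> x _; apply: cvgB; [exact: cg|exact: cf].
Qed.

Lemma cvg_sumr (T I : Type) (r : seq I) (H : set_system T) {FF : Filter H}
    (f : I -> T -> R) (a : I -> R) :
  (forall i, f i x @[x --> H] --> a i) ->
  \sum_(i <- r) f i x @[x --> H] --> \sum_(i <- r) a i.
Proof.
move=> h; elim: r => [|i r IH].
  by rewrite big_nil; under eq_cvg do rewrite big_nil; exact: cvg_cst.
by rewrite big_cons; under eq_cvg do rewrite big_cons; apply: cvgD.
Qed.

Lemma mulmx_cont n m (W : 'M[R]_(n, m)) : continuous (fun t : 'rV[R]_n => t *m W).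
Proof.
move=> t; apply: (@cvg_rowP _ _ (nbhs t)) => j; rewrite mxE.
under eq_cvg do rewrite mxE.
by apply: cvg_sumr => i; apply: cvgMr_tmp; exact: coord_continuous.
Qed.

Lemma row_mx_cont (T : topologicalType) n m (f : T -> 'rV[R]_n) (g : T -> 'rV[R]_m) x :
  {for x, continuous f} -> {for x, continuous g} ->
  {for x, continuous (fun x => row_mx (f x) (g x))}.
Proof.
move=> cf cg; apply: (@cvg_rowP _ _ (nbhs x)) => j; rewrite mxE; under eq_cvg do rewrite mxE.
case: (fintype.split j) => i.
  exact: (cvg_comp _ _ cf (@coord_continuous _ _ _ ord0 i (f x))).
exact: (cvg_comp _ _ cg (@coord_continuous _ _ _ ord0 i (g x))).
Qed.

Lemma compact_unif_cont n m (A : set 'rV[R]_n) (f : 'rV[R]_n -> 'rV[R]_m) (e : R) :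
  compact A -> continuous f -> 0 < e ->
  exists2 d : R, 0 < d & forall x y, A x -> `|x - y| < d -> `|f x - f y| < e.
Proof.
move=> /compact_near_coveringP cA cf e0.
suff : \forall d \near (0 : R)^'+, A `<=` [set x | forall y, `|x - y| < d -> `|f x - f y| < e].
  move=> h; have [d [d0 hd]] := @filter_ex R 0^'+ _ _ (@filterI R 0^'+ _ _ _ (nbhs_right_gt 0) h).
  by exists d => // x y Ax; apply: hd.
apply: (cA R 0^'+ (fun d x => forall y, `|x - y| < d -> `|f x - f y| < e)) => x Ax.
have e20 : 0 < e / 2 by rewrite divr_gt0.
move/cvgrPdist_lt: (cf x) => /(_ _ e20) /nbhs_ballP[r /= r0 hr].
exists (ball x (r / 2), [set d | d < r / 2]) => /=.
  split; first by apply: nbhsx_ballx; rewrite divr_gt0.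
  by apply: nbhs_right_lt; rewrite divr_gt0.
move=> [x' d] [/= xx' dr] y x'y.
rewrite -ball_normE /= in xx' hr.
have h1 : `|f x - f x'| < e / 2 by apply: hr; rewrite /= (lt_trans xx') // ltr_pdivrMr // ltr_pMr // ltr1n.
have h2 : `|f x - f y| < e / 2.
  apply: hr; rewrite /= (splitr r) -(subrKA x') (le_lt_trans (ler_normD _ _)) // ltrD //.
  exact: lt_trans dr.
rewrite -(subrKA (f x)) (le_lt_trans (ler_normD _ _)) // (splitr e) ltrD //.
by rewrite distrC.
Qed.

End RowVectors.

(** * The Borsuk-Ulam theorem *)

Section BorsukUlam.
Context {R : realType}.

(** A thick sphere for the supremum norm: it contains the images of [hemisphere]
    below and serves as test set of large genus. *)
Definition shell s : set (@matrix R 1 s) := [set x | 2^-1 <= `|x| <= 1].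

Lemma shell_compact s : compact (@shell s).
Proof.
apply: bounded_closed_compact.
  by exists 1; split => // M M1 x /= /andP[_ /le_trans]; apply; apply: ltW.
have -> : @shell s = [set x : 'rV[R]_s | 2^-1 <= `|x|] `&` [set x | `|x| <= 1].
  by apply/seteqP; split => x /=; [move=> /andP[]|move=> [h1 h2]; apply/andP].
by apply: closedI; apply: closed_le_fun; (exact: norm_continuous || exact: cst_continuous).
Qed.

(** The unit ball of R^m placed as an upper hemisphere of R^(m+1), so that
    antipodal points of its boundary become antipodal vectors. *)
Definition hemisphere m (y : 'rV[R]_m) : 'rV[R]_m.+1 :=
  \row_j (if unlift ord0 j is Some i then y ord0 i else 1 - `|y|).

Lemma hemisphere_shell m (y : 'rV[R]_m) : `|y| <= 1 -> shell (hemisphere y).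
Proof.
move=> y1; apply/andP; split; last first.
  apply/norm_leP => // j; rewrite mxE; case: unliftP => [i _|_].
    exact: le_trans (coord_le_norm y i) y1.
  by have := normr_ge0 y; rewrite ger0_norm; lra.
have [h|h] := leP `|y| 2^-1.
  apply: le_trans (coord_le_norm _ ord0); rewrite mxE unlift_none ger0_norm; lra.
have [i yi] : exists i, `|y| = `|y ord0 i| by apply: norm_attained; lra.
apply: le_trans (coord_le_norm _ (lift ord0 i)).
by rewrite mxE liftK -yi ltW.
Qed.

Lemma hemisphere_lip m (y y' : 'rV[R]_m) :
  `|hemisphere y - hemisphere y'| <= `|y - y'|.
Proof.
apply/norm_leP => // j; rewrite !mxE; case: unliftP => [i _|_].
  by have := coord_le_norm (y - y') i; rewrite !mxE.
have -> : 1 - `|y| - (1 - `|y'|) = `|y'| - `|y| by ring.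
by rewrite (distrC y); apply: ler_dist_dist.
Qed.

Lemma hemisphere_odd m (y : 'rV[R]_m) : `|y| = 1 -> hemisphere (- y) = - hemisphere y.
Proof.
move=> y1; apply/rowP => j; rewrite !mxE; case: unliftP => [i _|_]; rewrite ?mxE //.
by rewrite normrN y1 subrr oppr0.
Qed.

(** If [psi] had no zero, its norm would be at least some [e] > 0 on the shell.
    Label a grid cell by a coordinate of [psi], read on the hemisphere at the
    centre of the cell, whose absolute value is at least [e], together with its
    sign. On a fine grid the opposite labels given by Tucker's lemma contradict
    uniform continuity. *)
Lemma borsuk_ulam m t (psi : 'rV[R]_m.+1 -> 'rV[R]_t) : (t <= m)%N ->
  continuous psi -> (forall x, psi (- x) = - psi x) ->
  exists2 x, shell x & psi x = 0.
Proof.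
move=> tm cpsi opsi; apply: contrapT => nz.
have nz' x : shell x -> 0 < `|psi x|.
  by move=> sx; rewrite normr_gt0; apply/eqP => E; apply: nz; exists x.
have [x0 /[!inE] sx0 hx0] : exists2 c, c \in @shell m.+1 & forall t0, t0 \in @shell m.+1 -> `|psi c| <= `|psi t0|.
  apply: (@compact_EVT_min _ _ (fun x => `|psi x|)); last first.
  - by apply: continuous_subspaceT => x; apply: continuous_comp; [exact: cpsi|exact: norm_continuous].
  - exact: shell_compact.
  - by exists (hemisphere 0); apply: hemisphere_shell; rewrite normr0.
set e := `|psi x0| in hx0; have e0 : 0 < e by apply: nz'.
have [d d0 hd] := compact_unif_cont (@shell_compact m.+1) cpsi e0.
have [N N0 Nd] : exists2 N, (0 < N)%N & (N * 2)%:R^-1 < d.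
  exists (Num.truncn d^-1).+1 => //; set N := _.+1.
  rewrite invf_plt ?posrE // ?ltr0n ?muln_gt0 //.
  by apply: lt_le_trans (truncnS_gt _) _; rewrite ler_nat -/N leq_pmulr.
pose K : R := (N * 2)%:R.
have K0 : 0 < K by rewrite /K ltr0n muln_gt0 N0.
pose pt (c : {ffun 'I_m -> 'I_(N * 4).+1}) : 'rV[R]_m := \row_j (((c j)%:R - K) / K).
have pt1 c : `|pt c| <= 1.
  apply/norm_leP => // j; rewrite mxE normrM normfV (gtr0_norm K0) ler_pdivrMr // mul1r.
  have : ((c j)%:R : R) <= (N * 4)%:R by rewrite ler_nat -ltnS.
  have : 0 <= ((c j)%:R : R) by [].
  have -> : (N * 4)%:R = K + K :> R by rewrite /K -natrD; congr (_%:R); lia.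
  by rewrite ler_norml => *; apply/andP; split; lra.
have ptN c : pt (antipode c) = - pt c.
  have cM j : (c j <= N * 4)%N by rewrite -ltnS.
  have E j : antipode c j = (N * 4 - c j)%N :> nat by rewrite ffunE [LHS]/= subSS.
  apply/rowP => j; rewrite !mxE E natrB; last exact: cM.
  have -> : (N * 4)%:R = K + K :> R by rewrite /K -natrD; congr (_%:R); lia.
  by rewrite -mulNr; congr (_ / _); ring.
have ptbd c : on_boundary c -> `|pt c| = 1.
  move=> /existsP[j hj]; apply/eqP; rewrite eq_le pt1 /=.
  apply: le_trans (coord_le_norm _ j); rewrite mxE.
  case/orP: hj => /eqP ->.
    by rewrite sub0r mulNr divff ?gt_eqF // normrN1.
  have -> : (N * 4)%:R = K + K :> R by rewrite /K -natrD; congr (_%:R); lia.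
  by rewrite addrK divff ?gt_eqF // normr1.
pose v c := psi (hemisphere (pt c)).
have vS c : shell (hemisphere (pt c)) by apply: hemisphere_shell.
have big c : exists i, e <= `|v c ord0 i|.
  have : 0 < `|v c| by apply: nz'.
  by move=> /norm_attained[i E]; exists i; rewrite -E; apply: hx0; rewrite inE.
pose idx c := xchoose (big c).
pose lab c : 'I_m * bool := (widen_ord tm (idx c), 0 < v c ord0 (idx c)).
have idxP c : e <= `|v c ord0 (idx c)| := xchooseP (big c).
have lab_antipode c : on_boundary c -> lab (antipode c) = opp_label (lab c).
  move=> bc.
  have vN : v (antipode c) = - v c by rewrite /v ptN hemisphere_odd ?ptbd // opsi.
  have EP : (fun i => e <= `|v (antipode c) ord0 i|) =1 (fun i => e <= `|v c ord0 i|).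
    by move=> i; rewrite vN mxE normrN.
  have Ei : idx (antipode c) = idx c by apply: eq_xchoose.
  rewrite /lab /opp_label /= Ei vN mxE oppr_gt0; congr pair.
  have ne : v c ord0 (idx c) != 0 by rewrite -normr_gt0 (lt_le_trans e0).
  by rewrite -leNgt lt_neqAle ne.
have [w [c [fwc E]]] := tucker N0 lab_antipode.
have E1 : idx w = idx c by apply: ord_inj; exact: (congr1 (fun l => val l.1) E).
have E2 := congr1 snd E; rewrite /= in E2.
(* a face of c differs from c by at most one half-step of the grid *)
have close : `|v w - v c| < e.
  apply: hd => //; apply: le_lt_trans (hemisphere_lip _ _) (le_lt_trans _ Nd).
  apply/norm_leP => [|j]; first by rewrite invr_ge0.
  rewrite !mxE -mulrBl opprB addrA subrK normrM normfV (gtr0_norm K0) -[leRHS]mul1r.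
  rewrite ler_pM2r ?invr_gt0 //.
  case: (fwc j) => [->|[_ [_ [->|->]]]].
  + by rewrite subrr normr0.
  + by rewrite -natr1 addrAC subrr add0r normr1.
  + by rewrite -natr1 opprD addrA subrr sub0r normrN normr1.
have := le_lt_trans (coord_le_norm _ (idx c)) close; rewrite !mxE.
have := idxP w; have := idxP c; rewrite E1; move: E2; rewrite E1.
set a := v c _ _; set b := v w _ _.
case: (ltP 0 a) => ha; case: (ltP 0 b) => hb //= _.
  by rewrite (gtr0_norm ha) (ler0_norm hb) ltr_norml; lra.
by rewrite (gtr0_norm hb) (ler0_norm ha) ltr_norml; lra.
Qed.

End BorsukUlam.

(** * Genus and min-max values *)

Section Genus.
Context {R : realType}.

Lemma sphere_coord_le1 s (y : 'rV[R]_s) j : sphere y -> `|y ord0 j| <= 1.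
Proof.
move=> ys; rewrite -(@ler_pXn2r _ 2) ?nnegrE // real_normK ?num_real // expr1n.
move: ys; rewrite /sphere /= => <-; rewrite (bigD1 j) //= lerDl.
by apply: sumr_ge0 => i _; apply: sqr_ge0.
Qed.

Lemma sphere_neq0 s (y : 'rV[R]_s) : sphere y -> y != 0.
Proof.
move=> ys; apply/eqP => y0; move: ys; rewrite /sphere /= y0 big1 => [/eqP|i _].
  by rewrite eq_sym oner_eq0.
by rewrite mxE expr0n.
Qed.

(** Tietze's theorem in each coordinate, followed by taking the odd part. *)
Lemma odd_extension n s (A : set 'rV[R]_n) (phi : 'rV[R]_n -> 'rV[R]_s) :
  closed A -> (forall x, A x -> A (- x)) ->
  {within A, continuous phi} -> (forall x, A x -> sphere (phi x)) ->
  (forall x, A x -> phi (- x) = - phi x) ->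
  exists Phi : 'rV[R]_n -> 'rV[R]_s, [/\ continuous Phi,
    forall x, Phi (- x) = - Phi x & forall x, A x -> Phi x = phi x].
Proof.
move=> cA sA cphi sphi ophi.
have ext j : exists g : 'rV[R]_n -> R^o, continuous g /\ forall x, A x -> g x = phi x ord0 j.
  have [|x Ax|g [g1 g2 _]] := @continuous_bounded_extension _ R
    (@pseudometric_normal R 'rV[R]_n) A cA (fun x => phi x ord0 j) 1 ltr01.
  - move=> x; have := cphi x => cx.
    exact: (cvg_comp _ _ cx (@coord_continuous _ _ _ ord0 j (phi x))).
  - exact/sphere_coord_le1/sphi.
  - by exists g; split => // x Ax; rewrite g1 // inE.
have [g hg] := choice ext.
exists (fun x => \row_j ((g j x - g j (- x)) / 2)); split.
- move=> x; apply: (@cvg_rowP _ _ _ (nbhs x)) => j; rewrite mxE; under eq_cvg do rewrite mxE.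
  apply: cvgMr_tmp; apply: cvgB; first exact: (hg j).1.
  have h2 : g j y @[y --> - x] --> g j (- x) := (hg j).1 (- x).
  have h1 : - y @[y --> x] --> - x by exact: opp_continuous.
  exact: (cvg_comp _ _ h1 h2).
- by move=> x; apply/rowP => j; rewrite !mxE opprK -mulNr opprB.
- move=> x Ax; apply/rowP => j; rewrite mxE !(hg j).2 //; last exact: sA.
  by rewrite ophi // mxE; field.
Qed.

Lemma odd_nonzero_to_sphere n s (A : set 'rV[R]_n) (phi : 'rV[R]_n -> 'rV[R]_s) :
  {in A, continuous phi} -> (forall x, A x -> phi x != 0) ->
  (forall x, A x -> phi (- x) = - phi x) ->
  odd_map_to_sphere A s.
Proof.
move=> cphi nz ophi.
pose q x : R := \sum_i phi x ord0 i ^+ 2.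
have q0 x : A x -> 0 < q x.
  move=> /nz /rV0Pn[i xi]; rewrite /q (bigD1 i) //=.
  apply: ltr_pwDl; first by rewrite exprn_even_gt0.
  by apply: sumr_ge0 => j _; apply: sqr_ge0.
have coordc x i : A x -> (phi y ord0 i) @[y --> x] --> phi x ord0 i.
  move=> Ax; have cx : phi @ x --> phi x by apply: cphi; rewrite inE.
  exact: (cvg_comp _ _ cx (@coord_continuous _ _ _ ord0 i (phi x))).
exists (fun x => (Num.sqrt (q x))^-1 *: phi x); split.
- apply: continuous_in_subspaceT => x /[!inE] Ax.
  have h2 : phi @ x --> phi x by apply: cphi; rewrite inE.
  have hq : q @ x --> q x.
    apply: (@cvg_sumr R _ _ (index_enum 'I_s) (nbhs x) (nbhs_filter x) (fun i y => phi y ord0 i ^+ 2)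
  (fun i => phi x ord0 i ^+ 2)) => i.
    exact: (cvgM (coordc x i Ax) (coordc x i Ax)).
  have hs : Num.sqrt (q y) @[y --> x] --> Num.sqrt (q x).
    exact: (cvg_comp _ _ hq (@sqrt_continuous R (q x))).
  have h1 : (Num.sqrt (q y))^-1 @[y --> x] --> (Num.sqrt (q x))^-1.
    have ne : Num.sqrt (q x) != 0 by rewrite gt_eqF // sqrtr_gt0 q0.
    exact: (cvgV ne hs).
  exact: (cvgZ h1 h2).
- move=> x Ax; rewrite /sphere /=.
  under eq_bigr do rewrite mxE exprMn.
  by rewrite -mulr_sumr exprVn sqr_sqrtr ?ltW ?q0 // mulVf // gt_eqF // q0.
- move=> x Ax; have -> : q (- x) = q x.
    by apply: eq_bigr => i _; rewrite ophi // mxE sqrrN.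
  by rewrite ophi // scalerN.
Qed.

Lemma genus_exists n (A : set 'rV[R]_n) : A !=set0 -> symmetric_off0 A ->
  exists s, is_genus A s.
Proof.
move=> A0 [sA nA0].
have n0 : (0 < n)%N.
  case: n A A0 sA nA0 => // A [x Ax] _ []; suff -> : 0 = x by [].
  by apply/rowP => -[].
have ex : exists s, (0 < s)%N && `[< odd_map_to_sphere A s >].
  exists n; rewrite n0; apply/asboolP.
  apply: (@odd_nonzero_to_sphere _ _ _ id) => //; first by move=> x _; apply: cvg_id.
  move=> x Ax.
  by apply/eqP => x0; apply: nA0; rewrite -x0.
case: (ex_minnP ex) => s /andP[s0 /asboolP os] smin.
exists s; split => // t t1 ot; apply: smin; rewrite t1; exact/asboolP.
Qed.

Lemma genus_le n (A : set 'rV[R]_n) s t : is_genus A s -> odd_map_to_sphere A t ->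
  (0 < t)%N -> (s <= t)%N.
Proof. by case=> _ _ _ _ h ot t0; apply: h. Qed.

Section Family.
Context {n : nat} (F G : 'rV[R]_n -> R).

Lemma minmax_le i lam A : minmax_family i A -> (forall x, A x -> F x / G x <= lam) ->
  (minmax_eigenvalue F G i <= lam%:E)%E.
Proof.
move=> fA hA; apply: ge_ereal_inf; exists (ereal_sup [set (F x / G x)%:E | x in A]).
  by exists A.
by apply: ge_ereal_sup => _ [x Ax <-]; rewrite lee_fin hA.
Qed.

Lemma minmax_ge i lam : (forall A, minmax_family i A -> exists2 x, A x & lam <= F x / G x) ->
  (lam%:E <= minmax_eigenvalue F G i)%E.
Proof.
move=> h; apply: le_ereal_inf_tmp => _ [A fA <-].
have [x Ax hx] := h A fA.
by apply: le_ereal_sup_tmp; exists (F x / G x)%:E; [exists x|rewrite lee_fin].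
Qed.

Lemma minmax_lt i lam : (minmax_eigenvalue F G i < lam%:E)%E ->
  exists2 A, minmax_family i A & forall x, A x -> F x / G x < lam.
Proof.
move=> /ereal_inf_ltP[_ [A fA <-] h]; exists A => // x Ax.
by rewrite -lte_fin; apply: le_lt_trans h; apply: ereal_sup_ubound; exists x.
Qed.

Variables (s : nat) (W : 'M[R]_(s, n)) (lam : R).
Hypothesis W_free : forall t : 'rV[R]_s, t *m W = 0 -> t = 0.
Hypothesis W_ratio : forall t : 'rV[R]_s, t != 0 -> F (t *m W) / G (t *m W) = lam.

Let shell_neq0 (t : 'rV[R]_s) : shell t -> t != 0.
Proof.
by move=> /andP[h _]; rewrite -normr_gt0; apply: lt_le_trans h; rewrite invr_gt0.
Qed.

(** The shell of the subspace has genus at least [s] by the Borsuk-Ulam theorem. *)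
Lemma subspace_minmax_le i : (1 <= i <= s)%N ->
  (minmax_eigenvalue F G i <= lam%:E)%E.
Proof.
case: s W W_free W_ratio shell_neq0 => [|m] W' Wf Wr sn0 /andP[i1 i_s].
  by move: i1; rewrite leqNgt ltnS i_s.
pose A := (fun t : 'rV[R]_m.+1 => t *m W') @` @shell R m.+1.
have cA : compact A.
  by apply: continuous_compact; [apply: continuous_subspaceT; exact: mulmx_cont|exact: shell_compact].
have sA : symmetric_off0 A.
  split => [_ [t st <-]|[t st /Wf t0]].
    by exists (- t); [rewrite /shell /= normrN|rewrite mulNmx].
  by have := sn0 _ st; rewrite t0 eqxx.
have A0 : A !=set0.
  by exists (hemisphere 0 *m W'), (hemisphere 0) => //; apply: hemisphere_shell; rewrite normr0.
have [g gA] := genus_exists A0 sA.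
apply: (@minmax_le _ _ A); last by move=> _ [t /sn0 t0 <-]; rewrite Wr.
split => //; exists g; split => //.
apply: leq_trans i_s _; rewrite leqNgt; apply/negP => gs.
have [_ _ g1 [phi [cphi sphi ophi]] _] := gA.
have cloA : closed A by apply: compact_closed cA; exact: norm_hausdorff.
have [Phi [cPhi oPhi ePhi]] := odd_extension cloA sA.1 cphi sphi ophi.
have [|||t st] := @borsuk_ulam R m g (fun t => Phi (t *m W')).
- by rewrite -ltnS.
- by move=> t; exact: (cvg_comp _ _ (@mulmx_cont R _ _ W' t) (cPhi (t *m W'))).
- by move=> t; rewrite mulNmx oPhi.
have At : A (t *m W') by exists t.
by rewrite ePhi // => E0; have := sphere_neq0 (sphi _ At); rewrite E0 eqxx.
Qed.

(** A symmetric set that misses the subspace is sent by a projection along it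
    into R^(n - s) minus the origin, so that its genus is at most [n - s]. *)
Lemma subspace_minmax_ge i : (s <= n)%N -> (n < i + s)%N ->
  (lam%:E <= minmax_eigenvalue F G i)%E.
Proof.
move=> sn i_s; apply: minmax_ge => A [cA [sA nA0] [g [gA ig]]].
suff [t At] : exists t : 'rV[R]_s, A (t *m W).
  exists (t *m W) => //; rewrite W_ratio //; apply/eqP => t0.
  by apply: nA0; rewrite t0 mul0mx in At.
apply: contrapT => nt.
have Wr : row_free W.
  apply/row_freeP; exists (pinvmx W); apply/row_matrixP => j.
  apply/eqP; rewrite -subr_eq0 -linearB /=; apply/eqP; apply: W_free.
  by rewrite -row_mul mulmxBl mulmxKpV ?mul1mx ?subrr ?linear0.
have rW : \rank W = s by apply/eqP.
pose P := col_base (cokermx W).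
have P0 x : x *m P = 0 -> exists t, x = t *m W.
  move=> xP; apply/submxP; rewrite submxE.
  by rewrite -(mulmx_base (cokermx W)) mulmxA xP mul0mx.
have oA : forall x, A x -> x *m P != 0.
  by move=> x Ax; apply/eqP => /P0[t E]; apply: nt; exists t; rewrite -E.
have rP : \rank (cokermx W) = (n - s)%N by rewrite mxrank_coker rW.
have [A0 _ g1 _ _] := gA.
have [r0|r0] := posnP (\rank (cokermx W)).
  case: A0 => x Ax; have := oA _ Ax; apply/negP; rewrite negbK; apply/eqP/rowP => j.
  by exfalso; have := ltn_ord j; rewrite {2}r0.
have : (g <= \rank (cokermx W))%N.
  apply: (genus_le gA) => //.
  apply: (@odd_nonzero_to_sphere _ _ _ (fun x => x *m P)) => //.
    by move=> x _; apply: mulmx_cont.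
  by move=> x _; rewrite mulNmx.
rewrite rP; lia.
Qed.

End Family.
End Genus.

(** * Locally Lipschitz functions *)

Section LocallyLipschitz.
Context {R : realType} {n : nat}.
Implicit Types (F G : 'rV[R]_n -> R) (x y : 'rV[R]_n).

Definition loclip F x := exists L r : R, [/\ 0 <= L, 0 < r &
  forall y z, `|y - x| < r -> `|z - x| < r -> `|F y - F z| <= L * `|y - z|].

Lemma loclip_lip F x (L : R) : (forall y z, `|F y - F z| <= L * `|y - z|) -> loclip F x.
Proof.
move=> h; exists `|L|, 1; split => // y z _ _; apply: le_trans (h y z) _.
by rewrite ler_wpM2r // ler_norm.
Qed.

Lemma loclip_cst (c : R) x : loclip (fun=> c) x.
Proof. by apply: (@loclip_lip _ _ 0) => y z; rewrite subrr normr0 mul0r. Qed.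

Lemma loclipD F G x : loclip F x -> loclip G x -> loclip (fun y => F y + G y) x.
Proof.
move=> [L [r [L0 r0 h]]] [L' [r' [L0' r0' h']]].
exists (L + L'), (Num.min r r'); split; [by rewrite addr_ge0|by rewrite lt_min r0|].
move=> y z; rewrite !lt_min => /andP[y1 y2] /andP[z1 z2].
rewrite opprD addrACA mulrDl (le_trans (ler_normD _ _)) // lerD //; [exact: h|exact: h'].
Qed.

Lemma loclipM F G x : loclip F x -> loclip G x -> loclip (fun y => F y * G y) x.
Proof.
move=> [L [r [L0 r0 h]]] [L' [r' [L0' r0' h']]].
pose B := `|F x| + L * r; pose B' := `|G x| + L' * r'.
have bF y : `|y - x| < r -> `|F y| <= B.
  move=> yr; rewrite -(subrK (F x) (F y)) (le_trans (ler_normD _ _)) // addrC lerD2l.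
  have /(le_trans (h y x yr _)) : L * `|y - x| <= L * r by rewrite ler_wpM2l // ltW.
  by apply; rewrite subrr normr0.
have bG y : `|y - x| < r' -> `|G y| <= B'.
  move=> yr; rewrite -(subrK (G x) (G y)) (le_trans (ler_normD _ _)) // addrC lerD2l.
  have /(le_trans (h' y x yr _)) : L' * `|y - x| <= L' * r' by rewrite ler_wpM2l // ltW.
  by apply; rewrite subrr normr0.
have B0 : 0 <= B by rewrite addr_ge0 // mulr_ge0 // ltW.
have B0' : 0 <= B' by rewrite addr_ge0 // mulr_ge0 // ltW.
exists (L * B' + B * L'), (Num.min r r'); split.
- by rewrite addr_ge0 // mulr_ge0.
- by rewrite lt_min r0.
move=> y z; rewrite !lt_min => /andP[y1 y2] /andP[z1 z2].
have -> : F y * G y - F z * G z = (F y - F z) * G y + F z * (G y - G z) by ring.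
rewrite (le_trans (ler_normD _ _)) // [leRHS]mulrDl lerD // normrM.
  by rewrite mulrAC ler_pM // ?h ?bG.
by rewrite -mulrA ler_pM // ?bF // h'.
Qed.

Lemma loclip_sum (I : Type) (s : seq I) (F : I -> 'rV[R]_n -> R) x :
  (forall i, loclip (F i) x) -> loclip (fun y => \sum_(i <- s) F i y) x.
Proof.
move=> h; elim: s => [|i s IH].
  have -> : (fun y => \sum_(i <- [::]) F i y) = fun=> 0 by apply/funext => y; rewrite big_nil.
  exact: loclip_cst.
have -> : (fun y => \sum_(i <- i :: s) F i y) = fun y => F i y + \sum_(i <- s) F i y.
  by apply/funext => y; rewrite big_cons.
exact: loclipD.
Qed.

Lemma loclip_prod (I : Type) (s : seq I) (F : I -> 'rV[R]_n -> R) x :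
  (forall i, loclip (F i) x) -> loclip (fun y => \prod_(i <- s) F i y) x.
Proof.
move=> h; elim: s => [|i s IH].
  have -> : (fun y => \prod_(i <- [::]) F i y) = fun=> 1 by apply/funext => y; rewrite big_nil.
  exact: loclip_cst.
have -> : (fun y => \prod_(i <- i :: s) F i y) = fun y => F i y * \prod_(i <- s) F i y.
  by apply/funext => y; rewrite big_cons.
exact: loclipM.
Qed.

Lemma loclip_continuous F x : loclip F x -> F @ x --> F x.
Proof.
move=> [L [r [L0 r0 h]]]; apply/(@cvgrPdist_lt _ _ _ (nbhs x) (nbhs_filter x)) => e e0.
have [d d0 hd] : exists2 d, 0 < d & L * d < e.
  exists (e / (L + 1)); first by rewrite divr_gt0 // ltr_pwDr.
  by rewrite mulrCA gtr_pMr // ltr_pdivrMr ?mul1r ?ltrDl // ltr_pwDr.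
apply/nbhs_ballP; exists (Num.min d r) => /=; first by rewrite lt_min d0.
move=> y; rewrite -ball_normE /= lt_min => /andP[y1 y2].
apply: (@le_lt_trans _ _ (L * `|x - y|)); first by apply: h; rewrite ?subrr ?normr0 // distrC.
by apply: le_lt_trans hd; rewrite ler_wpM2l // ltW.
Qed.

End LocallyLipschitz.

(** * Regularity and homogeneity of the multilinear extension *)

Section OrderStatistics.
Context {R : realType} {n : nat}.
Implicit Types (x y : 'rV[R]_n).

Let size_sorted x : size (sort <=%R [seq x ord0 j | j <- enum 'I_n]) = n.
Proof. by rewrite size_sort size_map size_enum_ord. Qed.

Lemma order_stat_coord x i : (i < n)%N -> exists j, x ord0 j = order_stat x i.+1.
Proof.
move=> i_n; have /mapP[j _ E] : order_stat x i.+1 \in [seq x ord0 j | j <- enum 'I_n].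
  by rewrite -(mem_sort <=%R); apply: mem_nth; rewrite size_sort size_map size_enum_ord.
by exists j.
Qed.

Lemma coord_order_stat x j : exists2 i, (i < n)%N & order_stat x i.+1 = x ord0 j.
Proof.
have : x ord0 j \in sort <=%R [seq x ord0 j | j <- enum 'I_n].
  by rewrite mem_sort; apply/mapP; exists j; rewrite ?mem_enum.
by move=> /(nthP 0)[i]; rewrite size_sorted => i_n E; exists i.
Qed.

Lemma order_stat_le x i i' : (0 < i <= i')%N -> (i' <= n)%N ->
  order_stat x i <= order_stat x i'.
Proof.
case: i i' => [//|i] [//|i'] /=; rewrite !ltnS => ii i'n.
rewrite /order_stat /=; set s := sort _ _; have ss : sorted <=%R s := sort_sorted (@le_total _ _) _.
have sz : size s = n by rewrite size_sort size_map size_enum_ord.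
apply: (sorted_leq_nth (@le_trans _ _) (@lexx _ _) 0 ss) => //; rewrite inE sz //.
exact: leq_ltn_trans i'n.
Qed.

Lemma order_stat_scale x (t : R) i : 0 < t -> order_stat (t *: x) i = t * order_stat x i.
Proof.
move=> t0; rewrite /order_stat.
have -> : [seq (t *: x) ord0 j | j <- enum 'I_n] = map ( *%R t) [seq x ord0 j | j <- enum 'I_n].
  by elim: (enum _) => //= j e ->; rewrite mxE.
have mono : relpre ( *%R t) <=%R = <=%R :> rel R.
  by apply/funext => a; apply/funext => b; rewrite /= ler_pM2l.
rewrite sort_map mono.
set s := sort _ _; case: i => [|i] /=; first by rewrite mulr0.
have [h|h] := ltnP i (size s); first by rewrite (nth_map 0).
by rewrite !nth_default ?size_map // mulr0.
Qed.

Lemma upper_set_scale x (t : R) i : 0 < t -> upper_set (t *: x) i = upper_set x i.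
Proof.
move=> t0; rewrite /upper_set; case: ifP => // _; apply/setP => j.
by rewrite !inE order_stat_scale // mxE ltr_pM2l.
Qed.

(** The length of the set of levels at which the upper level set of [x] is [A],
    or the least coordinate of [x] when [A] is everything. Grouping the
    extension by level sets makes it a polynomial in these lengths, which,
    unlike [upper_set], depend continuously on [x]. *)
Definition weight (A : {set 'I_n}) x : R :=
  \sum_(i < n | upper_set x i == A) (order_stat x i.+1 - order_stat x i).

Lemma in_upper_set x i j : (0 < i)%N -> (j \in upper_set x i) = (order_stat x i < x ord0 j).
Proof. by case: i => // i _; rewrite /upper_set /= inE. Qed.

Section ProperSubset.
Variable A : {set 'I_n}.
Hypothesis AT : A != [set: 'I_n]%SET.

Let idx_gt0 x (i : nat) : upper_set x i = A -> (0 < i)%N.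
Proof. by case: i => // E; move: AT; rewrite -E /upper_set /= eqxx. Qed.

Let term_ge0 x (i : 'I_n) : upper_set x i = A -> 0 <= order_stat x i.+1 - order_stat x i.
Proof. by move=> /idx_gt0 i0; rewrite subr_ge0 order_stat_le // i0 /=. Qed.

Lemma weight_ge0 x : 0 <= weight A x.
Proof. by apply: sumr_ge0 => i /eqP /term_ge0. Qed.

(** A single index carries the whole weight: if two indices have the same upper
    set, the increment at the smaller one vanishes. *)
Lemma weight_le x a b : 0 < weight A x -> a \in A -> b \notin A ->
  weight A x <= x ord0 a - x ord0 b.
Proof.
move=> w0 aA bA.
have [/existsP[i /andP[/eqP iA di]]|/existsPn H] := boolP [exists i : 'I_n,
    (upper_set x i == A) && (0 < order_stat x i.+1 - order_stat x i)]; last first.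
  suff : weight A x <= 0 by rewrite leNgt w0.
  by apply: sumr_le0 => i iA; have := H i; rewrite iA /= -leNgt.
have i0 := idx_gt0 iA; rewrite subr_gt0 in di.
have -> : weight A x = order_stat x i.+1 - order_stat x i.
  rewrite /weight (bigD1 i) ?iA //= big1 ?addr0 // => i' /andP[/eqP i'A ne].
  have i0' := idx_gt0 i'A.
  apply/eqP; rewrite eq_le term_ge0 // andbT leNgt; apply/negP; rewrite subr_gt0 => di'.
  have step (u v : 'I_n) : upper_set x u = A -> upper_set x v = A ->
      order_stat x u < order_stat x u.+1 -> ~ (u < v)%N.
    move=> uA vA du uv; have [j jE] := order_stat_coord x (ltn_ord u).
    have : j \in A by rewrite -uA in_upper_set ?(idx_gt0 uA) // jE.
    rewrite -vA in_upper_set ?(idx_gt0 vA) // jE ltNge order_stat_le //=.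
    exact: ltnW.
  have [h|h|h] := ltngtP i i'; [exact: step iA i'A di h|exact: step i'A iA di' h|].
  by move: ne; rewrite -(inj_eq val_inj) /= h eqxx.
have [ia ian iaE] := coord_order_stat x a.
apply: lerB.
  rewrite -iaE order_stat_le //= ltnS leqNgt; apply/negP => h.
  have : a \in A by [].
  by rewrite -iA in_upper_set // -iaE ltNge order_stat_le //= ltnW.
by move: bA; rewrite -iA in_upper_set // -leNgt.
Qed.

(** If [A] lies strictly above its complement, the index of the largest coordinate
    outside [A] contributes such a gap. *)
Lemma weight_ge x : A != finset.set0 ->
  exists a b, [/\ a \in A, b \notin A & x ord0 a - x ord0 b <= weight A x].
Proof.
move=> /set0Pn[a0 a0A].
have [b0 b0A] : exists b, b \in ~: A.
  by apply/set0Pn; apply: contra AT => /eqP h; rewrite -(finset.setCK A) h finset.setC0.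
case: (boolP [exists a in A, [exists b in ~: A, x ord0 a <= x ord0 b]]).
  move=> /existsP[a /andP[aA /existsP[b /andP[bA h]]]]; exists a, b; split => //.
    by rewrite inE in bA.
  by apply: le_trans (weight_ge0 x); rewrite subr_le0.
move=> /existsPn H.
have {}H a b : a \in A -> b \notin A -> x ord0 b < x ord0 a.
  move=> aA bA; rewrite ltNge; apply/negP => h; have := H a; rewrite aA /= => /existsPn/(_ b).
  by rewrite inE bA h.
have [b bA0 bmax] := @arg_maxP _ _ _ b0 (mem (~: A)) (fun j => x ord0 j) b0A.
have bA : b \notin A by have : b \in ~: A := bA0; rewrite inE.
have [ib ibn ibE] := coord_order_stat x b.
have exi : exists i, (i < n)%N && (order_stat x i.+1 <= x ord0 b).
  by exists ib; rewrite ibn ibE lexx.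
have bnd i : (i < n)%N && (order_stat x i.+1 <= x ord0 b) -> (i <= n)%N.
  by move=> /andP[/ltnW].
(* [i.+1] is the last index whose order statistic does not exceed [x ord0 b] *)
case: (ex_maxnP exi bnd) => i /andP[i_n ile] imax.
have iE : order_stat x i.+1 = x ord0 b.
  apply/eqP; rewrite eq_le ile -ibE order_stat_le //= ltnS imax //.
  by rewrite ibn ibE lexx.
have i1n : (i.+1 < n)%N.
  rewrite ltnNge; apply/negP => ni.
  have [ia ian iaE] := coord_order_stat x a0.
  have := H a0 b a0A bA; rewrite -iaE -iE ltNge order_stat_le //=.
  by rewrite ltnS -ltnS (leq_trans ian).
have gt : x ord0 b < order_stat x i.+2.
  rewrite ltNge; apply/negP => h; have := imax i.+1; rewrite i1n h => /(_ isT).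
  by rewrite ltnn.
have [a aE] := order_stat_coord x i1n.
have uA : upper_set x i.+1 = A.
  apply/setP => j; rewrite in_upper_set // iE; apply/idP/idP => [|/H]; last by apply.
  move=> h; rewrite -[_ \in _]negbK; apply/negP => jA.
  have jC : j \in ~: A by rewrite inE.
  by have le : x ord0 j <= x ord0 b := bmax j jC; rewrite leNgt h in le.
exists a, b; split => //.
  by rewrite -uA in_upper_set // iE aE.
rewrite /weight (bigD1 (Ordinal i1n)) /= ?uA // aE -iE lerDl.
by apply: sumr_ge0 => l /andP[/eqP /term_ge0].
Qed.

(** Where the weight is positive it is at most each gap between [A] and its
    complement, and everywhere it is at least one of these gaps; gaps are
    2-Lipschitz. *)
Lemma weight_lip_half x y : A != finset.set0 ->
  weight A x - weight A y <= 2 * `|x - y|.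
Proof.
move=> A0; have [w0|w0] := leP (weight A x) 0.
  apply: (@le_trans _ _ 0); last by rewrite mulr_ge0.
  by rewrite subr_le0 (le_trans w0) // weight_ge0.
have [a [b [aA bA h]]] := weight_ge y A0.
have := weight_le w0 aA bA.
have := coord_le_norm (x - y) a; have := coord_le_norm (x - y) b; rewrite !mxE !ler_norml.
move=> /andP[? ?] /andP[? ?]; lra.
Qed.

End ProperSubset.

Lemma weightT x : (0 < n)%N -> weight [set: 'I_n]%SET x = order_stat x 1.
Proof.
move=> n0; rewrite /weight (big_pred1 (Ordinal n0)) /=; first by rewrite subr0.
move=> [[|i] i_n] /=; first by rewrite /upper_set /= !eqxx.
have [j jE] := order_stat_coord x (ltnW i_n).
apply/negbTE/negP => /eqP /setP/(_ j); rewrite in_upper_set // inE jE ltxx //.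
Qed.

Lemma weight_lip A : A != finset.set0 ->
  forall x y, `|weight A x - weight A y| <= 2 * `|x - y|.
Proof.
move=> A0 x y; have [->|AT] := eqVneq A [set: 'I_n]%SET; last first.
  by rewrite ler_norml lerNl opprB {1}(distrC x) !weight_lip_half.
have n0 : (0 < n)%N by case/set0Pn: A0 => a _; apply: leq_ltn_trans (ltn_ord a).
rewrite !weightT //.
have half (u v : 'rV[R]_n) : order_stat u 1 - order_stat v 1 <= 2 * `|u - v|.
  have [j jE] := order_stat_coord v n0; have [i i_n iE] := coord_order_stat u j.
  have := coord_le_norm (u - v) j; rewrite -jE !mxE ler_norml => /andP[_ h].
  have : order_stat u 1 <= u ord0 j by rewrite -iE order_stat_le.
  have := normr_ge0 (u - v); lra.
by rewrite ler_norml lerNl opprB {1}(distrC x) !half.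
Qed.

End OrderStatistics.

Section Multilinear.
Context {R : realType} {n k : nat}.
Variable h : {ffun 'I_k -> {set 'I_n}} -> R.

Lemma mlext_diag_weight (x : 'rV[R]_n) : mlext_diag h x =
  \sum_(A : {ffun 'I_k -> {set 'I_n}}) (\prod_s weight (A s) x) * zero_on_empty h A.
Proof.
rewrite /mlext_diag /mlext.
rewrite (partition_big (fun i : {ffun 'I_k -> 'I_n} => [ffun s => upper_set x (i s)]) xpredT) //=.
apply: eq_bigr => A _.
rewrite /weight bigA_distr_big_dep mulr_suml; apply: eq_big => [i|i /eqP ->//].
apply/eqP/familyP => [<- s|H]; first by rewrite unfold_in ffunE.
by apply/ffunP => s; rewrite ffunE; apply/eqP/(H s).
Qed.

Lemma mlext_diag_loclip (x : 'rV[R]_n) : loclip (mlext_diag h) x.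
Proof.
have -> : mlext_diag h = fun x => \sum_(A : {ffun 'I_k -> {set 'I_n}}) (\prod_s weight (A s) x) * zero_on_empty h A.
  by apply/funext => y; exact: mlext_diag_weight.
apply: loclip_sum => A.
rewrite /zero_on_empty; case: ifP => [_|/negbT /existsPn A0].
  have -> : (fun y : 'rV[R]_n => (\prod_s weight (A s) y) * 0) = fun=> 0.
    by apply/funext => y; rewrite mulr0.
  exact: loclip_cst.
apply: loclipM; last exact: loclip_cst.
apply: loclip_prod => s; apply: (@loclip_lip _ _ _ _ 2); exact: weight_lip.
Qed.

Lemma mlext_diag_scale (x : 'rV[R]_n) (t : R) : 0 < t ->
  mlext_diag h (t *: x) = t ^+ k * mlext_diag h x.
Proof.
move=> t0; rewrite /mlext_diag /mlext mulr_sumr; apply: eq_bigr => i _.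
rewrite mulrA; congr (_ * _); last first.
  by congr zero_on_empty; apply/ffunP => s; rewrite !ffunE upper_set_scale.
rewrite -[k in t ^+ k]card_ord -prodr_const -big_split /=.
by apply: eq_bigr => s _; rewrite !order_stat_scale // mulrBr.
Qed.

End Multilinear.

(** * Hahn-Banach separation for cones *)

Section DotProduct.
Context {R : realType} {n : nat}.
Implicit Types (v w xi : 'rV[R]_n).

Definition dot xi v : R := \sum_(j < n) xi ord0 j * v ord0 j.

Lemma dotZr xi (c : R) v : dot xi (c *: v) = c * dot xi v.
Proof. by rewrite /dot mulr_sumr; apply: eq_bigr => j _; rewrite mxE mulrCA. Qed.
Lemma dotZl xi (c : R) v : dot (c *: xi) v = c * dot xi v.
Proof. by rewrite /dot mulr_sumr; apply: eq_bigr => j _; rewrite mxE mulrA. Qed.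
Lemma dotNr xi v : dot xi (- v) = - dot xi v.
Proof. by rewrite -scaleN1r dotZr mulN1r. Qed.
Lemma dot_self_le0 xi : dot xi xi <= 0 -> xi = 0.
Proof.
move=> h; apply/rowP => j; rewrite mxE; apply/eqP; rewrite -sqrf_eq0.
rewrite eq_le sqr_ge0 andbT; apply: le_trans h.
by rewrite /dot (bigD1 j) //= -expr2 lerDl sumr_ge0 // => i _; rewrite -expr2 sqr_ge0.
Qed.

(** [T v c] reads: [c] bounds a sublinear functional at [v]. Working with the
    epigraph avoids introducing the functional and its infima. *)
Definition cone_above (T : 'rV[R]_n -> R -> Prop) :=
  [/\ forall v c w d, T v c -> T w d -> T (v + w) (c + d),
      forall v c (t : R), 0 < t -> T v c -> T (t *: v) (t * c),
      forall v, exists c, T v c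
    & forall c, T 0 c -> 0 <= c].

Definition invariant_along (T : 'rV[R]_n -> R -> Prop) (u : 'rV[R]_n) :=
  exists s : R, forall v c (t : R), T v c -> T (v + t *: u) (c + t * s).

(** [T] is enlarged by the line through [(u, s)], where [s] is the infimum of the
    bounds at [u]: the largest slope that leaves no negative bound at 0. *)
Lemma cone_extend T u : cone_above T -> exists T', [/\ cone_above T',
  forall v c, T v c -> T' v c, invariant_along T' u &
  forall w, invariant_along T w -> invariant_along T' w].
Proof.
move=> [Tadd Tscale Ttot T0].
pose D := [set d | T u d]; pose s := inf D.
have opp d e : T u d -> T (- u) e -> - e <= d.
  by move=> h1 h2; rewrite -subr_ge0 opprK; apply: T0; rewrite -(subrr u); apply: Tadd.
have D0 : D !=set0 by have [c Tc] := Ttot u; exists c.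
have Dlb : has_lbound D.
  by have [e Te] := Ttot (- u); exists (- e) => d Td; apply: opp.
exists (fun v c => exists t : R, T (v + t *: u) (c + t * s)); split.
- split.
  + move=> v c w d [t h] [t' h']; exists (t + t').
    by rewrite scalerDl mulrDl addrACA [X in T _ X]addrACA; apply: Tadd.
  + move=> v c a a0 [t h]; exists (a * t).
    by rewrite -scalerA -scalerDr -mulrA -mulrDr; apply: Tscale.
  + by move=> v; have [c h] := Ttot v; exists c, 0; rewrite scale0r mul0r !addr0.
  + move=> c [t]; rewrite add0r; have [t0|t0|->] := ltgtP t 0.
    * move=> h; have t1 : 0 < (- t)^-1 by rewrite invr_gt0 oppr_gt0.
      have := Tscale _ _ _ t1 h; rewrite scalerA.
      have -> : (- t)^-1 * t = -1 by rewrite invrN mulNr mulVf // lt_eqF.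
      rewrite scaleN1r => h'.
      have : - ((- t)^-1 * (c + t * s)) <= s.
        by apply: lb_le_inf => // d Td; apply: opp.
      have -> : - ((- t)^-1 * (c + t * s)) = c / t + s by field; rewrite lt_eqF.
      rewrite gerDr => h2; rewrite -[c](divfK (x := t)) ?lt_eqF //.
      by rewrite nmulr_lge0.
    * move=> h; have t1 : 0 < t^-1 by rewrite invr_gt0.
      have := Tscale _ _ _ t1 h; rewrite scalerA mulVf ?gt_eqF // scale1r => h'.
      have : s <= t^-1 * (c + t * s) by apply: ge_inf.
      by rewrite mulrDr mulKf ?gt_eqF // lerDr pmulr_rge0.
    * by rewrite scale0r mul0r addr0; apply: T0.
- by move=> v c h; exists 0; rewrite scale0r mul0r !addr0.
- exists s => v c t [t' h]; exists (t' - t).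
  by rewrite -!addrA -scalerDl -mulrDl addrCA subrr addr0.
- move=> w [s' hs']; exists s' => v c t [t' h]; exists t'.
  by rewrite addrAC [X in T _ X]addrAC; apply: hs'.
Qed.

(** Extending along every basis vector makes the functional linear, with the
    chosen slopes as coordinates. *)
Lemma hahn_banach_cone T : cone_above T ->
  exists xi, forall v c, T v c -> dot xi v <= c.
Proof.
move=> cT.
have [T' [cT' TT' inv]] : exists T', [/\ cone_above T', forall v c, T v c -> T' v c &
    forall j, j \in enum 'I_n -> invariant_along T' (delta_mx ord0 j)].
  elim: (enum _) => [|j js [T1 [cT1 TT1 inv1]]]; first by exists T.
  have [T' [cT' T1T' invu invw]] := cone_extend (delta_mx ord0 j) cT1.
  exists T'; split => // [v c /TT1/T1T' //|i].
  by rewrite inE => /predU1P[->//|/inv1/invw].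
have [s hs] := choice (fun j => inv j (mem_enum _ j)).
exists (\row_j s j) => v c /TT' Tvc.
have : T' (v - \sum_(j < n) v ord0 j *: delta_mx ord0 j) (c - \sum_(j < n) v ord0 j * s j).
  elim: (index_enum _) => [|j js IH]; first by rewrite !big_nil !subr0.
  rewrite !big_cons !opprD !addrA addrAC [X in T' _ X]addrAC -scaleNr -mulNr.
  exact: hs.
rewrite -row_sum_delta subrr => h.
have [_ _ _ /(_ _ h)] := cT'; rewrite subr_ge0 /dot.
by apply: le_trans; apply: ler_sum => j _; rewrite mxE mulrC.
Qed.

End DotProduct.

(** * Clarke subdifferentials *)

Section Descent.
Context {R : realType} {n : nat}.
Implicit Types (F G : 'rV[R]_n -> R) (x y v w xi : 'rV[R]_n).

(** [a] bounds the difference quotients of [F] in direction [v] near [x]; the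
    infimum of such [a] is the Clarke directional derivative. *)
Definition slope_le F x v (a : R) := exists2 r : R, 0 < r &
  forall y t, `|y - x| < r -> 0 < t < r -> F (y + t *: v) - F y <= a * t.

Lemma shift_near x v (r : R) : 0 < r -> exists r' : R, [/\ 0 < r', r' <= r &
  forall y t, `|y - x| < r' -> 0 < t < r' -> `|y + t *: v - x| < r].
Proof.
move=> r0; have v0 : 0 < 2 * (1 + `|v|) by rewrite mulr_gt0 // ltr_pwDl.
exists (r / (2 * (1 + `|v|))); split; first by rewrite divr_gt0.
  by rewrite ler_pdivrMr // ler_peMr // 1?ltW //; have := normr_ge0 v; lra.
move=> y t yx /andP[t0 tr]; rewrite addrAC (le_lt_trans (ler_normD _ _)) //.
rewrite normrZ gtr0_norm //.
apply: (@lt_le_trans _ _ (r / (2 * (1 + `|v|)) + r / (2 * (1 + `|v|)) * `|v|)).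
  by rewrite ltr_leD // ler_wpM2r // ltW.
rewrite -[X in X + _]mulr1 -mulrDr mulrAC ler_pdivrMr // ler_pM2l //.
by have := normr_ge0 v; lra.
Qed.

(** The supremum of the quotients over a small product neighbourhood is itself a
    bound in the sense of [slope_le]. *)
Lemma clarkeP F x xi : clarke F x xi <-> forall v a, slope_le F x v a -> dot xi v <= a.
Proof.
split=> [cl v a [r r0 h]|H v].
  rewrite -lee_fin; apply: le_trans (cl v) _; apply: ge_ereal_inf.
  pose V := [set p : 'rV[R]_n * R | `|p.1 - x| < r /\ 0 < p.2 < r].
  exists (ereal_sup [set ((F (p.1 + p.2 *: v) - F p.1) / p.2)%:E | p in V]).
    exists V => //; exists (ball x r, [set t | 0 < t < r]) => /=.
      split; first exact: nbhsx_ballx.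
      near=> t; apply/andP; split; [by []|].
      by near: t; apply: nbhs_right_lt.
    move=> [y t] /= [xy ht]; split => //=.
    by rewrite -ball_normE /= in xy; rewrite distrC.
  apply: ge_ereal_sup => _ [[y t] /= [yx /andP[t0 tr]] <-].
  by rewrite lee_fin ler_pdivrMr // h // t0.
apply: le_ereal_inf_tmp => _ [V [[A B] /= [Ax B0] AB] <-].
have /nbhs_ballP[rA rA0 hA] := Ax.
have [rB rB0 hB] : exists2 r : R, 0 < r & forall t, 0 < t < r -> B t.
  have /nbhs_ballP[r r0 hr] := B0; exists r => // t /andP[t0 tr].
  by apply: hr => //=; rewrite -ball_normE /= sub0r normrN gtr0_norm.
pose r := Num.min rA rB; have r0 : 0 < r by rewrite lt_min rA0.
have inV y t : `|y - x| < r -> 0 < t < r -> V (y, t).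
  rewrite lt_min => /andP[ya _] /andP[t0]; rewrite lt_min => /andP[_ tb].
  apply: AB; split => /=; last by apply: hB; rewrite t0.
  by apply: hA; rewrite -ball_normE /= distrC.
set S := [set _ | _ in _].
have ub y t : `|y - x| < r -> 0 < t < r -> (((F (y + t *: v) - F y) / t)%:E <= ereal_sup S)%E.
  by move=> h1 h2; apply: ereal_sup_ubound; exists (y, t) => //; apply: inV.
have r2 : 0 < r / 2 < r by rewrite divr_gt0 // ltr_pdivrMr // ltr_pMr // ltr1n.
case E : (ereal_sup S) => [s| |]; rewrite ?leey //; last first.
  by have := ub x (r / 2); rewrite subrr normr0 E => /(_ r0 r2).
rewrite lee_fin; apply: H; exists r => // y t h1 h2.
have := ub y t h1 h2; rewrite E lee_fin ler_pdivrMr //.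
by case/andP: h2.
Unshelve. all: by end_near. Qed.

Lemma slope_le_exists F x v : loclip F x -> exists a, slope_le F x v a.
Proof.
move=> [L [r [L0 r0 h]]]; exists (L * `|v|).
have [r' [r'0 r'r h']] := shift_near x v r0.
exists r' => // y t yx ht; apply: le_trans (ler_norm _) _.
apply: le_trans (h _ _ _ _) _; [exact: h'|exact: lt_le_trans r'r|].
case/andP: ht => t0 _.
by rewrite addrAC subrr add0r normrZ gtr0_norm // mulrA mulrAC.
Qed.

Lemma slope_leD F x v w a b : slope_le F x v a -> slope_le F x w b -> slope_le F x (v + w) (a + b).
Proof.
move=> [r r0 h] [s s0 h']; have [s' [s'0 s's hs]] := shift_near x v s0.
exists (Num.min r s') => [|y t]; first by rewrite lt_min r0.
rewrite !lt_min => /andP[yr ys] /andP[t0 /andP[tr ts]].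
rewrite scalerDr addrA mulrDl.
have := h y t yr; rewrite t0 tr => /(_ isT).
have := h' (y + t *: v) t; rewrite hs ?t0 ?ts // (lt_le_trans ts) // => /(_ isT isT).
lra.
Qed.

Lemma slope_leZ F x v a (c : R) : 0 < c -> slope_le F x v a -> slope_le F x (c *: v) (c * a).
Proof.
move=> c0 [r r0 h]; exists (Num.min r (r / c)) => [|y t].
  by rewrite lt_min r0 divr_gt0.
rewrite !lt_min => /andP[yr _] /andP[t0 /andP[_ tr]].
have := h y (t * c) yr; rewrite mulr_gt0 // -ltr_pdivlMr // tr => /(_ isT).
by rewrite scalerA [c * a]mulrC -mulrA [c * t]mulrC.
Qed.

Lemma slope_le0_ge0 F x a : slope_le F x 0 a -> 0 <= a.
Proof.
move=> [r r0 /(_ x (r / 2))]; rewrite subrr normr0 scaler0 addr0 subrr.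
have r2 : 0 < r / 2 < r by rewrite divr_gt0 // ltr_pdivrMr // ltr_pMr // ltr1n.
by move=> /(_ r0 r2); rewrite pmulr_lge0 //; case/andP: r2.
Qed.

Lemma slope_le00 F x : slope_le F x 0 0.
Proof. by exists 1 => // y t _ _; rewrite scaler0 addr0 subrr mul0r. Qed.

Lemma slope_le_near F x v a : slope_le F x v a ->
  exists2 r : R, 0 < r & forall y, `|y - x| < r -> slope_le F y v a.
Proof.
move=> [r r0 h]; have r20 : 0 < r / 2 by rewrite divr_gt0.
exists (r / 2) => // y yx; exists (r / 2) => // z t zy /andP[t0 tr].
apply: h; last by rewrite t0 (lt_trans tr) // ltr_pdivrMr // ltr_pMr // ltr1n.
by rewrite -(subrKA y) (le_lt_trans (ler_normD _ _)) // (splitr r) ltrD.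
Qed.

(** Moving by [- v] from [y] is moving by [v] towards [y] from a nearby point. *)
Lemma slope_le_opp F x v a : slope_le F x v a -> slope_le (fun y => - F y) x (- v) a.
Proof.
move=> [r r0 h]; have [s [s0 sr hs]] := shift_near x (- v) r0.
exists s => // y t ys ts; have := h (y + t *: - v) t (hs _ _ ys ts).
have -> : 0 < t < r by case/andP: ts => -> /lt_le_trans ->.
rewrite -addrA -scalerDr addNr scaler0 addr0 opprK addrC => /(_ isT) //.
Qed.

Lemma slope_le_scale F x v a (c : R) : 0 < c -> slope_le F x v a -> slope_le (fun y => c * F y) x v (c * a).
Proof.
move=> c0 [r r0 h]; exists r => // y t yr tr.
by rewrite -mulrBr -mulrA ler_pM2l // h.
Qed.

Lemma eq_slope_le F G x v a : F =1 G -> slope_le F x v a -> slope_le G x v a.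
Proof. by move=> /funext ->. Qed.

Lemma clarke_opp_mul_le G x v (lam b : R) eta : clarke G x eta ->
  slope_le (fun y => - lam * G y) x v b -> - lam * dot eta v <= b.
Proof.
move=> /clarkeP cl; have [l0|l0|l0] := ltgtP lam 0; last rewrite l0.
- have l1 : 0 < - lam by rewrite oppr_gt0.
  move=> /(slope_le_scale (c := (- lam)^-1)); rewrite invr_gt0 => /(_ l1).
  move=> /(eq_slope_le (G := G)) h; rewrite mulrC -ler_pdivlMr // mulrC.
  by apply: cl; apply: h => y; rewrite mulKf // gt_eqF.
- move=> /slope_le_opp /(slope_le_scale (c := lam^-1)); rewrite invr_gt0 => /(_ l0).
  move=> /(eq_slope_le (G := G)) h; rewrite mulNr -mulrN -dotNr mulrC -ler_pdivlMr // mulrC.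
  by apply: cl; apply: h => y; rewrite mulNr opprK mulKf // gt_eqF.
- rewrite oppr0 mul0r => -[r r0 /(_ x (r / 2))].
  have r2 : 0 < r / 2 < r by rewrite divr_gt0 // ltr_pdivrMr // ltr_pMr // ltr1n.
  by rewrite subrr normr0 => /(_ r0 r2); rewrite !mul0r subrr pmulr_lge0 //; case/andP: r2.
Qed.

(** A direction along which [F - lam * G] decreases near [x] at a definite rate,
    with the two summands controlled separately as in the notion of eigenpair. *)
Definition noncritical F G (lam : R) x := exists v a b, [/\ a + b < 0,
  slope_le F x v a & slope_le (fun y => - lam * G y) x v b].

Lemma noncritical_near F G lam x : noncritical F G lam x ->
  exists2 r : R, 0 < r & forall y, `|y - x| < r -> noncritical F G lam y.
Proof.
move=> [v [a [b [ab /slope_le_near[r r0 h] /slope_le_near[s s0 h']]]]].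
exists (Num.min r s) => [|y]; first by rewrite lt_min r0.
by rewrite lt_min => /andP[yr ys]; exists v, a, b; split; [|apply: h|apply: h'].
Qed.

Lemma eigenpair_not_noncritical F G lam x : eigenpair F G lam x -> ~ noncritical F G lam x.
Proof.
move=> [_ [xi [/clarkeP clF [eta clG E]]]] [v [a [b [ab dF dG]]]].
have h1 := clF _ _ dF; have h2 := clarke_opp_mul_le clG dG.
by rewrite -E dotZl in h1; move: ab h1 h2; clear; lra.
Qed.

Lemma clarke_nonempty G x : loclip G x -> exists eta, clarke G x eta.
Proof.
move=> lG; have [] := @hahn_banach_cone R n (slope_le G x).
  split; [exact: (fun v c w d => @slope_leD G x v w c d)|by move=> v c t; apply: slope_leZ| |exact: slope_le0_ge0].
  by move=> v; apply: slope_le_exists.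
by move=> eta h; exists eta; apply/clarkeP.
Qed.

(** The bounds [a + b] of [F] at [v + w] and of [- lam * G] at [w] form a cone;
    it has no negative bound at 0 exactly because [x] is not noncritical. A linear
    functional below it belongs to the Clarke subdifferential of [F] and to
    [lam] times that of [G]. *)
Lemma not_noncritical_eigenpair F G lam x : x != 0 -> loclip F x -> loclip G x ->
  ~ noncritical F G lam x -> eigenpair F G lam x.
Proof.
move=> x0 lF lG nc; split => //.
pose Q := fun y => - lam * G y.
have lQ : loclip Q x by apply: loclipM lG; apply: loclip_cst.
pose T v c := exists w a b, [/\ c = a + b, slope_le F x (v + w) a & slope_le Q x w b].
have cT : cone_above T.
  split.
  - move=> v c v' c' [w [a [b [-> h1 h2]]]] [w' [a' [b' [-> h1' h2']]]].
    exists (w + w'), (a + a'), (b + b'); split; [by rewrite addrACA| |exact: slope_leD].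
    by rewrite addrACA; apply: slope_leD.
  - move=> v c t t0 [w [a [b [-> h1 h2]]]]; exists (t *: w), (t * a), (t * b).
    split; [by rewrite mulrDr|rewrite -scalerDr; exact: (slope_leZ t0 h1)|exact: (slope_leZ t0 h2)].
  - move=> v; have [a h1] := slope_le_exists v lF.
    by exists (a + 0), 0, a, 0; rewrite !addr0; split => //; apply: slope_le00.
  - move=> c [w [a [b [-> h1 h2]]]]; rewrite leNgt; apply/negP => ab.
    by apply: nc; exists w, a, b; rewrite add0r in h1.
have [xi hxi] := hahn_banach_cone cT.
have xiF : clarke F x xi.
  apply/clarkeP => v a h; apply: hxi; exists 0, a, 0; rewrite !addr0; split => //.
  exact: slope_le00.
have xiQ w b : slope_le Q x w b -> - dot xi w <= b.
  move=> h; rewrite -dotNr; apply: hxi; exists w, 0, b; rewrite add0r addNr; split => //.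
  exact: slope_le00.
have [eta eE clG] : exists2 eta, lam *: eta = xi & clarke G x eta.
  have [l0|l0|l0] := ltgtP lam 0; last first.
  - have [eta clG] := clarke_nonempty lG; exists eta => //.
    have : slope_le Q x (- xi) 0.
      by exists 1 => // y t _ _; rewrite /Q l0 oppr0 !mul0r subrr.
    by move=> /xiQ; rewrite dotNr opprK l0 scale0r => /dot_self_le0 ->.
  - exists (lam^-1 *: xi); first by rewrite scalerA mulfV ?scale1r // gt_eqF.
    apply/clarkeP => v a /(slope_le_scale l0) /slope_le_opp.
    move=> /(eq_slope_le (G := Q)) => /(_ (fun y => esym (mulNr _ _))) /xiQ.
    by rewrite dotNr opprK dotZl [lam^-1 * _]mulrC ler_pdivrMr // [a * _]mulrC.
  - have l1 : 0 < - lam by rewrite oppr_gt0.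
    exists (lam^-1 *: xi); first by rewrite scalerA mulfV ?scale1r // lt_eqF.
    apply/clarkeP => v a /(slope_le_scale l1) /xiQ.
    by rewrite dotZl mulNr lerN2 [lam^-1 * _]mulrC ler_ndivrMr // [a * _]mulrC.
by exists xi; split => //; exists eta.
Qed.

(** Moving from [y] by [t * sg * x] is, up to a Lipschitz error of order
    [t * `|x - y|], a dilation of [y] by [1 + sg * t]. *)
Lemma slope_le_radial F x (k : nat) (sg e : R) : loclip F x -> `|sg| = 1 ->
  (forall y (t : R), 0 < t -> F (t *: y) = t ^+ k * F y) -> 0 < e ->
  slope_le F x (sg *: x) (sg * k%:R * F x + e).
Proof.
move=> lF sg1 hF e0; have [L [r [L0 r0 hL]]] := lF.
pose S (u : R) := \sum_(i < k) (1 + u) ^+ i.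
have powE u : (1 + u) ^+ k - 1 = u * S u by rewrite subrX1 addrC addKr.
have cS : S u @[u --> (0 : R)] --> S 0.
  apply: (@cvg_sumr R _ _ (index_enum 'I_k) (nbhs (0 : R)) _ (fun i u => (1 + u) ^+ i)) => i.
  have h1 : 1 + u @[u --> (0 : R)] --> 1 + (0 : R) by apply: cvgD; [exact: cvg_cst|exact: cvg_id].
  exact: (cvg_comp _ _ h1 (@exprn_continuous R i (1 + 0))).
have S0 : S 0 = k%:R.
  rewrite /S; under eq_bigr do rewrite addr0 expr1n.
  by rewrite sumr_const card_ord.
have cF := loclip_continuous lF.
have csg : sg * p.2 @[p --> (x, 0 : R)] --> (0 : R).
  have c2 : p.2 @[p --> (x, 0 : R)] --> (0 : R) by exact: cvg_snd.
  have := cvgMl_tmp (a := sg) c2; rewrite mulr0; exact.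
have c1 : p.1 @[p --> (x, 0 : R)] --> x by exact: cvg_fst.
have cP : S (sg * p.2) * F p.1 @[p --> (x, 0 : R)] --> S 0 * F x.
  exact: (cvgM (cvg_comp _ _ csg cS) (cvg_comp _ _ c1 cF)).
have e2 : 0 < e / 2 by rewrite divr_gt0.
move/cvgrPdist_lt: cP => /(_ _ e2) /nbhs_ballP[d /= d0 hd].
have x20 : 0 < 2 + `|x| by rewrite ltr_pwDl.
have L10 : 0 < L + 1 by rewrite ltr_pwDr.
(* [d] and 1 control the dilation, the next bound keeps all points in the
   Lipschitz ball, and the last one controls the Lipschitz error *)
pose q := Num.min (Num.min d 1) (Num.min (r / (2 + `|x|)) (e / 2 / (L + 1))).
have q0 : 0 < q by rewrite !lt_min d0 ltr01 !divr_gt0.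
exists q => // y t; rewrite !lt_min => /andP[/andP[yd y1] /andP[yr ye]].
move=> /andP[t0 /andP[/andP[td t1] /andP[tr te]]].
have st : `|sg * t| = t by rewrite normrM sg1 mul1r gtr0_norm.
have main : `|S 0 * F x - S (sg * t) * F y| < e / 2.
  apply: (hd (y, t)); split; rewrite -ball_normE /= ?sub0r ?normrN ?gtr0_norm //.
  by rewrite distrC.
have yx1 : `|y| <= `|x| + 1.
  by rewrite -(subrK x y) addrC (le_trans (ler_normD _ _)) // lerD2l ltW.
have aux (z : 'rV[R]_n) : `|z| <= `|x| + 1 -> `|y + t *: (sg *: z) - x| < r.
  move=> z1; rewrite addrAC (le_lt_trans (ler_normD _ _)) // scalerA (mulrC t) normrZ st.
  have rE : r = r / (2 + `|x|) + r / (2 + `|x|) * (`|x| + 1) by field; rewrite gt_eqF.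
  by rewrite [ltRHS]rE ltr_leD // ler_pM // ltW.
have near1 := aux x; rewrite lerDl ler01 in near1; have {}near1 := near1 isT.
have near2 := aux y yx1.
have lip := hL _ _ near1 near2.
have Ey : F (y + t *: (sg *: y)) = F y + sg * t * S (sg * t) * F y.
  rewrite scalerA -[X in X + _]scale1r -scalerDl hF ?(mulrC t) //.
    by rewrite -powE; ring.
  by have := ler_norm (- (sg * t)); rewrite normrN st; lra.
move: lip; rewrite opprD addrACA subrr add0r -scalerBr -scalerBr !normrZ sg1 mul1r gtr0_norm //.
rewrite ler_norml Ey => /andP[_ lip].
have lip2 : L * (t * `|x - y|) <= e / 2 * t.
  rewrite mulrCA mulrC ler_pM2r // distrC.
  have := ltW ye; rewrite ler_pdivlMr // => h; apply: le_trans h.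
  by rewrite mulrC ler_wpM2l // lerDl.
have sgb : sg * (S (sg * t) * F y - S 0 * F x) <= e / 2.
  apply: le_trans (ler_norm _) _; rewrite normrM sg1 mul1r distrC; exact: ltW.
rewrite S0 in sgb main.
have : t * (sg * (S (sg * t) * F y - k%:R * F x)) <= t * (e / 2) by rewrite ler_pM2l.
move: lip lip2; set A := F (_ + _); set B := S _; set C := F y; set D := F x; set P := L * _.
nra.
Qed.

(** Euler's identity for homogeneous functions, from the radial slopes along [x]
    and along [- x]. *)
Lemma clarke_euler F x (k : nat) xi : loclip F x ->
  (forall y (t : R), 0 < t -> F (t *: y) = t ^+ k * F y) ->
  clarke F x xi -> dot xi x = k%:R * F x.
Proof.
move=> lF hF /clarkeP cl; apply/eqP; rewrite eq_le; apply/andP; split.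
  apply/ler_addgt0Pr => e e0; have := cl _ _ (slope_le_radial lF (normr1 _) hF e0).
  by rewrite scale1r mul1r.
rewrite -lerN2; apply/ler_addgt0Pr => e e0.
have := cl _ _ (slope_le_radial lF (normrN1 _) hF e0).
by rewrite scaleN1r dotNr mulN1r mulNr.
Qed.

End Descent.

(** * Descent maps *)

Section LocalDescent.
Context {R : realType} {n : nat}.
Implicit Types (F G : 'rV[R]_n -> R) (x y v : 'rV[R]_n).

Lemma cvg_ball (f : 'rV[R]_n -> R) x (e : R) : f @ x --> f x -> 0 < e ->
  exists2 r : R, 0 < r & forall y, `|y - x| < r -> `|f y - f x| < e.
Proof.
move=> cf e0; move/cvgrPdist_lt: cf => /(_ _ e0) /nbhs_ballP[r /= r0 h].
by exists r => // y yx; rewrite distrC; apply: h; rewrite -ball_normE /= distrC.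
Qed.

Lemma ratio_cvg F G x : loclip F x -> loclip G x -> G x != 0 ->
  (fun y => F y / G y) @ x --> F x / G x.
Proof.
move=> lF lG G0; have cG := loclip_continuous lG; have cF := loclip_continuous lF.
exact: (cvgM cF (cvgV G0 cG)).
Qed.

(** The ratio decreases at [y] as soon as [F - J * G] does, with [J] the value of
    the ratio at [y]; since [J] is close to [lam], this differs little from
    [F - lam * G]. *)
Lemma ratio_descent_pos F G lam x v a b : loclip F x -> loclip G x ->
  0 < G x -> F x / G x = lam -> a + b < 0 ->
  slope_le F x v a -> slope_le (fun y => - lam * G y) x v b ->
  exists2 r : R, 0 < r & forall y t, `|y - x| < r -> 0 < t < r ->
    F (y + t *: v) / G (y + t *: v) < F y / G y.
Proof.
move=> lF lG G0 Jx ab [r1 r10 h1] [r2 r20 h2].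
have [r3 r30 h3] := cvg_ball (loclip_continuous lG) G0.
have [L [r4 [L0 r40 h4]]] := lG.
have M0 : 0 < L * `|v| + 1 by rewrite ltr_wpDl // mulr_ge0.
have c0 : 0 < - (a + b) / (L * `|v| + 1) by rewrite divr_gt0 // oppr_gt0.
have [r5 r50 h5] := cvg_ball (ratio_cvg lF lG (lt0r_neq0 G0)) c0.
have [r3' [r30' r33 h3']] := shift_near x v r30.
have [r4' [r40' r44 h4']] := shift_near x v r40.
exists (Num.min (Num.min r1 r2) (Num.min (Num.min r3' r4') r5)).
  by rewrite !lt_min r10 r20 r30' r40'.
move=> y t; rewrite !lt_min => /andP[/andP[y1 y2] /andP[/andP[y3 y4] y5]].
move=> /andP[t0 /andP[/andP[t1 t2] /andP[/andP[t3 t4] t5]]].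
have Gpos z : `|z - x| < r3 -> 0 < G z.
  by move=> /h3; rewrite ltr_norml => /andP[+ _]; lra.
have Gy : 0 < G y by apply: Gpos; apply: lt_le_trans r33.
have z3 := h3' _ t y3; have z4 := h4' _ t y4.
rewrite t0 t3 in z3; rewrite t0 t4 in z4.
move: (z3 isT) (z4 isT) => {z3 z4}; set z := y + t *: v => z3 z4.
have Gz : 0 < G z by apply: Gpos.
have d1 := h1 y t y1; rewrite t0 t1 in d1; have {}d1 := d1 isT.
have d2 := h2 y t y2; rewrite t0 t2 in d2; have {}d2 := d2 isT.
have d4 : `|G z - G y| <= L * (t * `|v|).
  have := h4 z y z4 (lt_le_trans y4 r44).
  by rewrite /z addrAC subrr add0r normrZ gtr0_norm.
have d5 := h5 y y5; rewrite Jx in d5.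
rewrite -/z in d1 d2.
rewrite ltr_pdivrMr //.
set J := F y / G y in d5 *.
have FyE : F y = J * G y by rewrite divfK // gt_eqF.
have key : - ((J - lam) * (G z - G y)) < - (a + b) * t.
  apply: le_lt_trans (ler_norm _) _; rewrite normrN normrM.
  apply: (@le_lt_trans _ _ (`|J - lam| * ((L * `|v| + 1) * t))).
    by rewrite ler_wpM2l // (le_trans d4) // mulrDl mul1r mulrCA (mulrC t) ler_wpDr // ltW.
  by rewrite mulrA ltr_pM2r // -ltr_pdivlMr.
move: d1 d2 key; rewrite FyE; set A := G z; set B := G y; set C := F z.
clear; nra.
Qed.

(** If [G x < 0], the same ratio is that of [- F] and [- G], for which [- v] is a
    direction of decrease. *)
Lemma ratio_descent F G lam x : loclip F x -> loclip G x ->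
  G x != 0 -> F x / G x = lam -> noncritical F G lam x ->
  exists v, exists2 r : R, 0 < r & forall y t, `|y - x| < r -> 0 < t < r ->
    F (y + t *: v) / G (y + t *: v) < F y / G y.
Proof.
move=> lF lG G0 Jx [v [a [b [ab dF dG]]]].
have [Gneg|Gpos|E] := ltgtP (G x) 0; last by rewrite E eqxx in G0.
  have oppE (f : 'rV[R]_n -> R) : (fun y => -1 * f y) = (fun y => - f y).
    by apply/funext => y; rewrite mulN1r.
  have lF' : loclip (fun y => - F y) x by rewrite -oppE; apply: loclipM lF; apply: loclip_cst.
  have lG' : loclip (fun y => - G y) x by rewrite -oppE; apply: loclipM lG; apply: loclip_cst.
  have [|||||r r0 h] := @ratio_descent_pos _ _ lam x (- v) a b lF' lG'.
  - by rewrite oppr_gt0.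
  - by rewrite invrN mulrNN.
  - exact: ab.
  - exact: slope_le_opp.
  - by apply: (eq_slope_le _ (slope_le_opp dG)) => y; rewrite mulrN.
  exists (- v), r => // y t yr tr.
  by have := h y t yr tr; rewrite !invrN !mulrNN.
exists v; exact: (ratio_descent_pos lF lG Gpos Jx ab dF dG).
Qed.

End LocalDescent.

Section Deformation.
Context {R : realType} {n : nat}.
Variables (J : 'rV[R]_n -> R).
Hypothesis J_even : forall x, J (- x) = J x.
Implicit Types (x y v : 'rV[R]_n) (eta : 'rV[R]_n -> 'rV[R]_n).

(** Where such a map does not decrease [J] it does not move the point. This
    alternative is what makes decrease survive compositions. *)
Definition descent_map eta := [/\ continuous eta, forall y, eta (- y) = - eta y,
  forall y, y != 0 -> eta y != 0 &
  forall y, y != 0 -> eta y = y \/ J (eta y) < J y].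

Lemma descent_map_id : descent_map id.
Proof. by split => // [y|y _]; [exact: cvg_id|left]. Qed.

Lemma descent_map_comp eta1 eta2 : descent_map eta1 -> descent_map eta2 ->
  descent_map (eta2 \o eta1) /\
  (forall y, y != 0 -> J (eta1 y) < J y \/ J (eta2 y) < J y -> J (eta2 (eta1 y)) < J y).
Proof.
move=> [c1 o1 n1 d1] [c2 o2 n2 d2].
have main y : y != 0 -> J (eta1 y) < J y \/ J (eta2 y) < J y -> J (eta2 (eta1 y)) < J y.
  move=> y0 H; have [E|lt1] := d1 y y0.
    by rewrite E; case: H => //; rewrite E ltxx.
  by have [->//|lt2] := d2 _ (n1 y y0); apply: lt_trans lt1.
split=> //; split.
- by move=> y; exact: (cvg_comp _ _ (c1 y) (c2 (eta1 y))).
- by move=> y /=; rewrite o1 o2.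
- by move=> y y0; apply/n2/n1.
- move=> y y0 /=; have [E1|lt1] := d1 y y0; last by right; apply: main => //; left.
  rewrite E1; exact: d2.
Qed.

Definition descending_ball x v (r : R) := [/\ 0 < r, r <= `|x| &
  forall y t, `|y - x| < r -> 0 < t < r -> y + t *: v != 0 /\ J (y + t *: v) < J y].

(** Push along [v] by a bump function at [x], and along [- v] by its mirror image
    at [- x]; the two supports are disjoint because [r <= `|x|]. *)
Lemma local_descent_map x v r : descending_ball x v r -> exists eta,
  descent_map eta /\ forall y, `|y - x| < r -> J (eta y) < J y.
Proof.
move=> [r0 rx H].
(* halving keeps the pushes shorter than [r] *)
pose rho y : R := Num.max 0 (r - `|y - x|) / 2.
pose eta y := y + (rho y - rho (- y)) *: v.
have rho_pos y : `|y - x| < r -> 0 < rho y < r.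
  move=> yx; have : 0 < r - `|y - x| by rewrite subr_gt0.
  rewrite /rho => h; rewrite max_r ?ltW //; have := normr_ge0 (y - x).
  by move=> ?; apply/andP; split; lra.
have rho0 y : r <= `|y - x| -> rho y = 0.
  by move=> yx; rewrite /rho max_l ?mul0r // subr_le0.
have disj y : `|y - x| < r -> r <= `|- y - x|.
  move=> yx; rewrite leNgt; apply/negP => yx'.
  have : `|(- y - x) + (y - x)| < r + r by rewrite (le_lt_trans (ler_normD _ _)) // ltrD.
  have -> : (- y - x) + (y - x) = - (x *+ 2).
    by rewrite addrACA addNr add0r mulr2n opprD.
  rewrite normrN normrMn mulr2n; lra.
have eta_odd y : eta (- y) = - eta y.
  rewrite /eta opprK [RHS]opprD -[in RHS]scaleNr; congr (_ + _ *: _); ring.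
have etaE y : `|y - x| < r -> exists2 t, 0 < t < r & eta y = y + t *: v.
  by move=> yx; exists (rho y); [exact: rho_pos|rewrite /eta (rho0 (- y)) ?subr0 //; apply: disj].
have crho : continuous rho.
  move=> z; apply: loclip_continuous; apply: (@loclip_lip _ _ _ _ 1) => u w; rewrite mul1r.
  have := ler_dist_dist (u - x) (w - x); rewrite opprB addrA subrK /rho.
  set a := `|u - x|; set b := `|w - x|; set d := `|u - w|.
  rewrite !ler_norml => /andP[h1 h2].
  by case: (leP 0 (r - a)) => ?; case: (leP 0 (r - b)) => ?; apply/andP; split; lra.
have strict y : `|y - x| < r -> J (eta y) < J y.
  by move=> yx; have [t tr ->] := etaE y yx; apply: (H _ _ _ _).2.
exists eta; split=> //; split => //.
- move=> y.
  have c1 : rho z - rho (- z) @[z --> y] --> rho y - rho (- y).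
    have h1 : - z @[z --> y] --> - y by exact: opp_continuous.
    exact: (cvgB (crho y) (cvg_comp _ _ h1 (crho (- y)))).
  exact: (cvgD cvg_id (cvgZ c1 (cvg_cst v))).
- move=> y y0; have [yx|yx] := ltP `|y - x| r.
    by have [t tr ->] := etaE y yx; apply: (H _ _ _ _).1.
  have [yx'|yx'] := ltP `|- y - x| r.
    have [t tr E] := etaE _ yx'.
    by rewrite -oppr_eq0 -eta_odd E; apply: (H _ _ _ _).1.
  by rewrite /eta !rho0 // subrr scale0r addr0.
- move=> y y0; have [yx|yx] := ltP `|y - x| r; first by right; apply: strict.
  have [yx'|yx'] := ltP `|- y - x| r.
    by right; rewrite -J_even -eta_odd -(J_even y); apply: strict.
  by left; rewrite /eta !rho0 // subrr scale0r addr0.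
Qed.

(** Compose the local maps of a finite cover: the first one that moves a point
    decreases [J] there, and the others never increase it. One such finite
    composition plays the role of a gradient flow. *)
Lemma compact_descent_map (C : set 'rV[R]_n) : compact C ->
  (forall x, C x -> x != 0) ->
  (forall x, C x -> exists v r, descending_ball x v r) ->
  exists eta, descent_map eta /\ forall y, C y -> J (eta y) < J y.
Proof.
move=> cC C0 HC.
have loc x : exists er : ('rV[R]_n -> 'rV[R]_n) * R, C x ->
    [/\ 0 < er.2, descent_map er.1 & forall y, `|y - x| < er.2 -> J (er.1 y) < J y].
  have [Cx|nC] := pselect (C x); last by exists (id, 0).
  have [v [r db]] := HC x Cx; have [eta [de he]] := local_descent_map db.
  by exists (eta, r) => _; split => //=; case: db.
have [er her] := choice loc.
move: cC; rewrite compact_cover => /(_ _ C (fun x => ball x (er x).2)).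
case=> [x Cx|x Cx|D DC cov].
- by apply: ball_open; case: (her x Cx).
- by exists x => //; apply: ballxx; case: (her x Cx).
have {cov} cov y : C y -> exists2 x, x \in (D : seq _) & `|y - x| < (er x).2.
  by move=> /cov[x /= xD]; rewrite -ball_normE /= distrC => yx; exists x.
have {}DC x : x \in (D : seq _) -> C x by move=> /DC /set_mem.
suff [eta [de he]] : exists eta, descent_map eta /\ forall x y, x \in (D : seq _) ->
    y != 0 -> `|y - x| < (er x).2 -> J (eta y) < J y.
  by exists eta; split => // y Cy; have [x xD yx] := cov y Cy; apply: (he x) => //; apply: C0.
elim: (D : seq _) DC => [|x s IH] DC; first by exists id; split => //; exact: descent_map_id.
have [eta1 [d1 h1]] := IH (fun z zs => DC z (mem_behead (s := x :: s) zs)).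
have [_ d2 h2] := her x (DC x (mem_head _ _)).
have [d12 h12] := descent_map_comp d1 d2.
exists ((er x).1 \o eta1); split => // z y; rewrite inE => /predU1P[->|zs] y0 yz /=.
  by apply: h12 => //; right; apply: h2.
by apply: h12 => //; left; apply: h1 zs y0 yz.
Qed.

End Deformation.

(** * Multiplicity of min-max values *)

Section LusternikSchnirelmann.
Context {R : realType} {n : nat}.
Variables (F G : 'rV[R]_n -> R) (k : nat).
Implicit Types (x y z : 'rV[R]_n).
Hypotheses (F_lip : forall x, loclip F x) (G_lip : forall x, loclip G x).
Hypotheses (F_even : forall x, F (- x) = F x) (G_even : forall x, G (- x) = G x).
Hypothesis G_neq0 : forall x, x != 0 -> G x != 0.
Hypothesis F_scale : forall x (t : R), 0 < t -> F (t *: x) = t ^+ k * F x.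
Hypothesis G_scale : forall x (t : R), 0 < t -> G (t *: x) = t ^+ k * G x.

Let J x := F x / G x.

Let J_even x : J (- x) = J x. Proof. by rewrite /J F_even G_even. Qed.

Let J_scale x (t : R) : 0 < t -> J (t *: x) = J x.
Proof.
move=> t0; rewrite /J F_scale // G_scale // -mulf_div divff ?mul1r //.
by rewrite expf_neq0 // gt_eqF.
Qed.

Let J_cvg x : x != 0 -> J @ x --> J x.
Proof. by move=> x0; apply: ratio_cvg => //; apply: G_neq0. Qed.

Definition unit_sphere : set 'rV[R]_n := [set x | `|x| = 1].

Lemma unit_sphere_neq0 x : unit_sphere x -> x != 0.
Proof. by move=> xS; rewrite -normr_gt0 xS. Qed.

Lemma closed_eq_fun (f g : 'rV[R]_n -> R) : continuous f -> continuous g ->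
  closed [set x | f x = g x].
Proof.
move=> cf cg; have -> : [set x | f x = g x] = [set x | f x <= g x] `&` [set x | g x <= f x].
  apply/seteqP; split => x /= => [->//|[h1 h2]].
  by apply/eqP; rewrite eq_le h1.
by apply: closedI; apply: closed_le_fun.
Qed.

Lemma unit_sphere_compact : compact unit_sphere.
Proof.
apply: bounded_closed_compact; last first.
  by apply: closed_eq_fun; [exact: norm_continuous|exact: cst_continuous].
by exists 1; split => // M M1 x /= ->; rewrite ltW.
Qed.

Definition normalize (x : 'rV[R]_n) := `|x|^-1 *: x.

Lemma normalize_sphere x : x != 0 -> unit_sphere (normalize x).
Proof.
by move=> x0; rewrite /unit_sphere /= normrZ normfV normr_id mulVf // normr_eq0.
Qed.

Lemma normalizeN x : normalize (- x) = - normalize x.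
Proof. by rewrite /normalize normrN scalerN. Qed.

Lemma normalize_cvg x : x != 0 -> normalize @ x --> normalize x.
Proof.
move=> x0.
have c1 : (fun y => `|y|) @ x --> `|x| by exact: norm_continuous.
have nx : `|x| != 0 by rewrite normr_eq0.
exact: (cvgZ (cvgV nx c1) cvg_id).
Qed.

(** Being noncritical is an open condition. *)
Lemma critical_sphere_closed lam : closed (unit_sphere `&` [set x | eigenpair F G lam x]).
Proof.
have -> : unit_sphere `&` [set x | eigenpair F G lam x] =
    unit_sphere `&` ~` [set x | noncritical F G lam x].
  apply/seteqP; split => x /= [xS h]; split => //.
    exact: eigenpair_not_noncritical.
  by apply: not_noncritical_eigenpair => //; apply: unit_sphere_neq0.
apply: closedI.
  by apply: closed_eq_fun; [exact: norm_continuous|exact: cst_continuous].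
apply: open_closedC; rewrite openE => x /= /noncritical_near[r r0 h].
apply/nbhs_ballP; exists r => // y; rewrite -ball_normE /= distrC; exact: h.
Qed.

Lemma closed_kernel s (Phi : 'rV[R]_n -> 'rV[R]_s) : continuous Phi ->
  closed [set x | Phi x = 0].
Proof.
move=> cPhi; have -> : [set x | Phi x = 0] = [set x | `|Phi x| = 0].
  by apply/seteqP; split => x /=; [move=> ->; rewrite normr0|move/normr0_eq0].
apply: closed_eq_fun; last exact: cst_continuous.
by move=> x; exact: (cvg_comp _ _ (cPhi x) (@norm_continuous _ _ (Phi x))).
Qed.

Lemma noncritical_ball lam x : x != 0 -> J x = lam -> ~ eigenpair F G lam x ->
  exists v r, descending_ball J x v r.
Proof.
move=> x0 Jx ne.
have nc : noncritical F G lam x.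
  by apply: contrapT => h; apply: ne; apply: not_noncritical_eigenpair.
have [v [r r0 h]] := ratio_descent (F_lip x) (G_lip x) (G_neq0 x0) Jx nc.
have nx0 : 0 < `|x| by rewrite normr_gt0.
have [r' [r0' rr' h']] := shift_near x v nx0.
exists v, (Num.min r r'); split.
- by rewrite lt_min r0.
- by rewrite ge_min rr' orbT.
move=> y t; rewrite !lt_min => /andP[y1 y2] /andP[t0 /andP[t1 t2]]; split.
  have := h' y t y2; rewrite t0 t2 => /(_ isT) lt1.
  by apply/eqP => E; move: lt1; rewrite E sub0r normrN ltxx.
by apply: h => //; rewrite t0.
Qed.

(** At a point [x] of [Z] either [J x > lam] or [J (eta x) < lam]; compactness
    makes this alternative uniform. *)
Lemma descent_gap eta (Z : set 'rV[R]_n) lam : descent_map J eta -> compact Z ->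
  (forall x, Z x -> x != 0) -> (forall x, Z x -> J x = lam -> J (eta x) < J x) ->
  exists2 e : R, 0 < e & forall x, Z x -> J x < lam + e -> J (eta x) <= lam - e.
Proof.
move=> [ceta oeta neta deta] cZ Z0 HZ.
have [[z Zz]|Zempty] := pselect (Z !=set0); last first.
  by exists 1 => // x Zx; exfalso; apply: Zempty; exists x.
pose h x : R := Num.max (J x - lam) (lam - J (eta x)).
have h0 x : Z x -> 0 < h x.
  move=> Zx; rewrite lt_max !subr_gt0; have [//|Jx] := ltP lam (J x).
  move: Jx; rewrite le_eqVlt => /predU1P[Jx|Jx]; first by rewrite -Jx HZ.
  by have [->//|lt1] := deta x (Z0 _ Zx); apply: lt_trans Jx.
have ch : {in Z, continuous h}.
  move=> x /[!inE] Zx.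
  have c1 : J y - lam @[y --> x] --> J x - lam.
    exact: (cvgB (J_cvg (Z0 _ Zx)) (cvg_cst lam)).
  have c2 : (J \o eta) y @[y --> x] --> J (eta x).
    exact: (cvg_comp _ _ (ceta x) (J_cvg (neta _ (Z0 _ Zx)))).
  have c3 : lam - J (eta y) @[y --> x] --> lam - J (eta x).
    exact: (cvgB (cvg_cst lam) c2).
  exact: (@continuous_max R _ (fun y => J y - lam) (fun y => lam - J (eta y)) x c1 c3).
have [|c /[!inE] Zc hc] := @compact_EVT_min _ _ h Z _ cZ (continuous_in_subspaceT ch).
  by exists z.
exists (h c); first exact: h0.
move=> x Zx Jx; have := hc x; rewrite inE => /(_ Zx).
by rewrite [leRHS]/h le_max => /orP[]; lra.
Qed.

Lemma ratio_normalize x : x != 0 -> J (normalize x) = J x.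
Proof. by move=> x0; apply: J_scale; rewrite invr_gt0 normr_gt0. Qed.

(** Lusternik and Schnirelmann's multiplicity theorem. An odd map [Phi] to R^r
    has no zero on the critical set of level [lam]. Take [A] of genus at least
    [m + r] on which the ratio is below [lam + e], and move the zeros of [Phi] in
    [A] by a descent map. If the result has genus at least [m], it shows that the
    [m]-th value is at most [lam - e]; otherwise [Phi] together with an odd map on
    the result sends [A] to too small a sphere. *)
Theorem minmax_multiplicity (m r : nat) (lam : R) : (0 < m)%N ->
  multiplicity_is F G lam r ->
  (lam%:E <= minmax_eigenvalue F G m)%E ->
  (minmax_eigenvalue F G (m + r) <= lam%:E)%E -> False.
Proof.
move=> m0 [_ [sK _] r0 [phi [cphi sphi ophi]] _] lam_le le_lam.
pose KS := unit_sphere `&` [set x | eigenpair F G lam x].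
have sKS x : KS x -> KS (- x).
  by move=> [xS xK]; split; [rewrite /unit_sphere /= normrN|exact: sK].
have [|||||Phi [cPhi oPhi ePhi]] := @odd_extension R n r KS phi.
- exact: critical_sphere_closed.
- exact: sKS.
- by apply: continuous_subspaceW cphi; apply: subIsetr.
- by move=> x [_ /sphi].
- by move=> x [_ /ophi].
pose Z := unit_sphere `&` [set x | Phi x = 0].
have cZ : compact Z.
  by apply: compact_closedI; [exact: unit_sphere_compact|exact: closed_kernel].
have Z0 x : Z x -> x != 0 by move=> [/unit_sphere_neq0].
pose C := Z `&` [set x | F x = lam * G x].
have cF : continuous F by move=> x; apply: loclip_continuous.
have cG : continuous G by move=> x; apply: loclip_continuous.
have cC : compact C.
  apply: compact_closedI => //; apply: closed_eq_fun => // x.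
  exact: (cvgMl_tmp (cG x)).
have JC x : x != 0 -> J x = lam <-> F x = lam * G x.
  move=> /G_neq0 Gx; split => [<-|E]; first by rewrite divfK.
  by rewrite /J E mulfK.
have [x [/Z0//]|x [[xS Zx] FG]|eta [deta eC]] := @compact_descent_map R n J J_even C cC.
  have x0 := unit_sphere_neq0 xS.
  apply: (@noncritical_ball lam) => //; first exact/JC.
  move=> xK; have KSx : KS x by split.
  have := sphere_neq0 (sphi x xK); rewrite -ePhi //.
  by move: Zx => /= ->; rewrite eqxx.
have [e e0 gap] : exists2 e : R, 0 < e & forall x, Z x -> J x < lam + e -> J (eta x) <= lam - e.
  apply: descent_gap => // x Zx Jx; apply: eC; split => //.
  by apply/JC => //; apply: Z0.
have : (minmax_eigenvalue F G (m + r) < (lam + e)%:E)%E.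
  by apply: le_lt_trans le_lam _; rewrite lte_fin ltrDl.
move=> /minmax_lt[A [cA [sA nA0] [gA [genA mr_g]]] ratA].
have A0 x : A x -> x != 0 by move=> Ax; apply/eqP => x0; apply: nA0; rewrite -x0.
have nrm_cont : {in A, continuous normalize}.
  by move=> x /[!inE] /A0; apply: normalize_cvg.
have Phin_cont : {in A, continuous (Phi \o normalize)}.
  move=> x xA; exact: (cvg_comp _ _ (nrm_cont x xA) (cPhi (normalize x))).
pose B := (normalize @` A) `&` [set x | Phi x = 0].
have cB : compact B.
  apply: compact_closedI; last exact: closed_kernel.
  by apply: continuous_compact cA; apply: continuous_in_subspaceT.
have BZ x : B x -> Z x.
  by move=> [[y Ay <-] Py]; split => //; apply/normalize_sphere/A0.
have [ceta oeta neta _] := deta.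
pose E := eta @` B.
(* [Phi] takes care of the points outside [B], and [Psi] of those in [B] *)
have genus_bound t (Psi : 'rV[R]_n -> 'rV[R]_t) : continuous Psi ->
    (forall x, Psi (- x) = - Psi x) -> (forall y, E y -> Psi y != 0) -> (gA <= r + t)%N.
  move=> cPsi oPsi nPsi; apply: (genus_le genA); last by rewrite ltn_addr.
  apply: (@odd_nonzero_to_sphere _ _ _ _ (fun x => row_mx (Phi (normalize x)) (Psi (eta (normalize x))))).
  - move=> x xA; apply: row_mx_cont; first exact: Phin_cont.
    have c1 := cvg_comp _ _ (nrm_cont x xA) (ceta (normalize x)).
    exact: (cvg_comp _ _ c1 (cPsi (eta (normalize x)))).
  - move=> x Ax; apply/eqP => /eqP; rewrite -row_mx0 => /eqP /eq_row_mx[P0 Q0].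
    have /nPsi/eqP : E (eta (normalize x)) by exists (normalize x) => //; split => //; exists x.
    by apply.
  - by move=> x Ax; rewrite normalizeN oPhi oeta oPsi -opp_row_mx.
have [[b Bb]|Bempty] := pselect (B !=set0); last first.
  pose Psi0 (x : 'rV[R]_n) : 'rV[R]_0 := 0.
  have : (gA <= r + 0)%N.
    apply: (genus_bound 0%N Psi0) => [x|x|y [x Bx]]; first exact: (@cst_continuous _ _ (0 : matrix R 1 0) x).
      by rewrite /Psi0 oppr0.
    by exfalso; apply: Bempty; exists x.
  rewrite addn0; lia.
have sB x : B x -> B (- x).
  move=> [[y Ay <-] /= Py]; split => /=; last by rewrite oPhi Py oppr0.
  by exists (- y); [exact: sA|rewrite normalizeN].
have sE : symmetric_off0 E.
  split => [_ [x Bx <-]|[x Bx E0]].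
    by exists (- x); [exact: sB|rewrite oeta].
  by have := neta x (Z0 _ (BZ _ Bx)); rewrite E0 eqxx.
have cE : compact E.
  by apply: continuous_compact cB; apply: continuous_subspaceT.
have E0 : E !=set0 by exists (eta b), b.
have [g genE] := genus_exists E0 sE.
have [mg|gm] := leqP m g.
  have : (minmax_eigenvalue F G m <= (lam - e)%:E)%E.
    apply: (@minmax_le _ _ _ _ _ _ E); first by split => //; exists g.
    move=> _ [x Bx <-]; apply: gap; first exact: BZ.
    have [[y Ay <-] _] := Bx.
    by rewrite ratio_normalize; [apply: ratA|apply: A0].
  move=> /(le_trans lam_le); rewrite lee_fin; lra.
have [_ _ g0 [psi [cpsi spsi opsi]] _] := genE.
have cloE : closed E by apply: compact_closed cE; exact: norm_hausdorff.
have [Psi [cPsi oPsi ePsi]] := odd_extension cloE sE.1 cpsi spsi opsi.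
have : (gA <= r + g)%N.
  by apply: genus_bound cPsi oPsi _ => y Ey; rewrite ePsi //; apply/sphere_neq0/spsi.
lia.
Qed.

End LusternikSchnirelmann.

(** * Counting indices and subspaces of constant ratio *)

Section Counting.
Variables (n a : nat) (P : pred 'I_n).
Hypothesis an : (a <= n)%N.

Let widen_inj : injective (widen_ord an).
Proof. by move=> i j /(congr1 val) /= E; apply: ord_inj. Qed.

Lemma card_ge_initial : (forall i : 'I_n, (i < a)%N -> P i) -> (a <= #|P|)%N.
Proof.
move=> H; rewrite -[leqLHS]card_ord -(card_codom widen_inj).
by apply: subset_leq_card; apply/fintype.subsetP => _ /codomP[i ->]; apply: H => /=.
Qed.

Lemma card_ge_final : (forall i : 'I_n, (n - a <= i)%N -> P i) -> (a <= #|P|)%N.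
Proof.
move=> H; rewrite -[leqLHS]card_ord.
have inj : injective (fun i : 'I_a => rev_ord (widen_ord an i)).
  by move=> i i' /rev_ord_inj /widen_inj.
rewrite -(card_codom inj).
apply: subset_leq_card; apply/fintype.subsetP => _ /codomP[i ->]; apply: H => /=.
have := ltn_ord i; lia.
Qed.

End Counting.

Section Subspaces.
Context {R : realType} {n : nat}.
Implicit Types (x : 'rV[R]_n).

Lemma delta_rows_free (A : {set 'I_n}) :
  let W := \matrix_(i < #|A|, j < n) (j == enum_val i)%:R : 'M[R]__ in
  (forall t : 'rV[R]_#|A|, t *m W = 0 -> t = 0) /\
  forall t : 'rV[R]_#|A|, supp (t *m W) \subset A.
Proof.
move=> W; have tW (t : 'rV[R]_#|A|) j : (t *m W) ord0 j = \sum_i t ord0 i * (j == enum_val i)%:R.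
  by rewrite mxE; apply: eq_bigr => i _; rewrite mxE.
split=> t => [h|].
  apply/rowP => i; have /rowP/(_ (enum_val i)) := h; rewrite tW [RHS]mxE mxE => <-.
  rewrite (bigD1 i) //= eqxx mulr1 big1 ?addr0 // => i' ne.
  by rewrite (inj_eq enum_val_inj) eq_sym (negPf ne) mulr0.
apply/fintype.subsetP => j; rewrite inE tW; apply: contraR => jA.
rewrite big1 // => i _; case: eqP => [E|_]; last by rewrite mulr0.
by move: jA; rewrite E enum_valP.
Qed.

Lemma restr_rows_free x s (U : 'I_s -> {set 'I_n}) :
  (forall i, U i != finset.set0 /\ U i \subset supp x) ->
  (forall i j, i != j -> (U i :&: U j)%SET = finset.set0) ->
  let W := \matrix_(i < s) restr x (U i) in
  (forall t : 'rV[R]_s, t *m W = 0 -> t = 0) /\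
  forall t : 'rV[R]_s, t *m W = \sum_(i < s) t ord0 i *: restr x (U i).
Proof.
move=> U1 U2 W.
have tW (t : 'rV[R]_s) : t *m W = \sum_(i < s) t ord0 i *: restr x (U i).
  by rewrite mulmx_sum_row; apply: eq_bigr => i _; rewrite rowK.
split=> // t; rewrite tW => h; apply/rowP => i; rewrite mxE.
have [/set0Pn[j jU] /fintype.subsetP/(_ j jU)] := U1 i; rewrite inE => xj.
have /rowP/(_ j) := h; rewrite summxE [RHS]mxE (bigD1 i) //= !mxE jU big1.
  by rewrite addr0 => /eqP; rewrite mulf_eq0 (negPf xj) orbF => /eqP.
move=> i' ne; rewrite !mxE; case: ifP => [jU'|_]; last by rewrite mulr0.
by have /setP/(_ j) := U2 _ _ ne; rewrite !inE jU jU'.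
Qed.

End Subspaces.

Theorem theorem1p5 (R : realType) (n k : nat)
    (f g : {ffun 'I_k -> {set 'I_n}} -> R) (F G : 'rV[R]_n -> R)
    (F_def : F = mlext_diag f) (G_def : G = mlext_diag g)
    (F_even : forall x, F (- x) = F x) (G_even : forall x, G (- x) = G x)
    (G_neq0 : forall x, x != 0 -> G x != 0) :
  (forall lam : R,
     (independence_number F G lam <=
        minn #|[pred i : 'I_n | (minmax_eigenvalue F G i.+1 <= lam%:E)%E]|
             #|[pred i : 'I_n | (lam%:E <= minmax_eigenvalue F G i.+1)%E]|)%N)
  /\
  (forall (j r : nat) (lam : R) (x : 'rV[R]_n),
     (1 <= j <= n)%N ->
     minmax_eigenvalue F G j = lam%:E ->
     multiplicity_is F G lam r ->
     eigenpair F G lam x ->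
     (split_number F G x <= minn (j + r - 1) (n - j + r))%N).
Proof.
have F_lip x : loclip F x by rewrite F_def; apply: mlext_diag_loclip.
have G_lip x : loclip G x by rewrite G_def; apply: mlext_diag_loclip.
have F_scale x (t : R) : 0 < t -> F (t *: x) = t ^+ k * F x.
  by rewrite F_def; apply: mlext_diag_scale.
have G_scale x (t : R) : 0 < t -> G (t *: x) = t ^+ k * G x.
  by rewrite G_def; apply: mlext_diag_scale.
split=> [lam|j r lam x /andP[j1 jn] lamj mult eig].
  apply/bigmax_leqP => A /asboolP HA.
  have An : (#|A| <= n)%N by rewrite -[leqRHS]card_ord max_card.
  pose W : 'M[R]_(#|A|, n) := \matrix_(i, j) (j == enum_val i)%:R.
  have [Wfree Wsupp] := delta_rows_free (R := R) A; rewrite -/W in Wfree Wsupp.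
  have Wratio t : t != 0 -> F (t *m W) / G (t *m W) = lam.
    by move=> t0; apply: HA; [apply: contra_neq t0 => /Wfree|exact: Wsupp].
  rewrite leq_min; apply/andP; split.
    apply: card_ge_initial => // i ia; apply: subspace_minmax_le Wfree Wratio _ _.
    by rewrite ltnS leq0n.
  apply: card_ge_final => // i ia; apply: subspace_minmax_ge Wfree Wratio _ An _.
  lia.
have xlam : F x / G x = lam.
  have [x0 [xi [clF [eta clG E]]]] := eig.
  have [k0|k0] := posnP k; last first.
    have := clarke_euler (F_lip x) F_scale clF; rewrite -E dotZl.
    rewrite (clarke_euler (G_lip x) G_scale clG) mulrCA => /mulfI.
    by rewrite pnatr_eq0 -lt0n k0 => /(_ isT) <-; rewrite mulfK // G_neq0.
  have cst y : F y / G y = F x / G x.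
    subst k F G; rewrite !mlext_diag_weight; congr (_ / _); apply: eq_bigr => A _;
      by rewrite !big_ord0.
  apply/eqP; rewrite eq_le -!lee_fin -lamj; apply/andP; split.
    apply: minmax_ge => A [_ _ [gA [[[y Ay] _ _ _ _] _]]].
    by exists y => //; rewrite cst.
  have [|A fA _] := @minmax_lt R n F G j (lam + 1).
    by rewrite lamj lte_fin ltrDl.
  by apply: (minmax_le fA) => y _; rewrite cst.
apply/bigmax_leqP => s /asboolP[U [U1 U2 Uratio]].
have sn : (s <= n)%N by rewrite -ltnS.
pose W := \matrix_(i < s) restr x (U i).
have [Wfree WE] := restr_rows_free U1 U2; rewrite -/W in Wfree WE.
have Wratio t : t != 0 -> F (t *m W) / G (t *m W) = lam.
  by move=> t0; rewrite WE Uratio.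
have LS := @minmax_multiplicity R n F G k F_lip G_lip F_even G_even G_neq0 F_scale G_scale.
rewrite leq_min; apply/andP; split; rewrite leqNgt; apply/negP => s_big.
  apply: (LS j r lam j1 mult); first by rewrite lamj.
  apply: subspace_minmax_le Wfree Wratio _ _; lia.
have rj : (r < j)%N by lia.
apply: (LS (j - r)%N r lam _ mult); first by rewrite subn_gt0.
  apply: subspace_minmax_ge Wfree Wratio _ sn _; lia.
by rewrite subnK ?lamj // ltnW.
Qed.
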